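(* Let $(X,d_X)$ be a compact geodesic metric space, $r\in X$, $d=d_X(r,\cdot)$, and let $(G,d_G)$ be either the metric Reeb graph of $d$ or the metric $\alpha$-Reeb graph of $d$ (for some $\alpha>0$ and covering $\mathcal I$), assumed to be a finite graph, with quotient map $\pi:X\to G$. Then \[ d_{GH}(X,G) < (\beta_1(G)+1)\,M, \] where $\beta_1(G)$ is the first Betti number of $G$ and $M=\sup_{p\in G}\operatorname{diam}(\pi^{-1}(p))$ (diameter in $d_X$).
   Context: Reeb graph: for $x,y\in X$ set $x\sim y$ iff $d(x)=d(y)$ and $x,y$ lie in the same path-connected component of $d^{-1}(d(x))$; $G=X/\sim$, with quotient map $\pi:X\to G$. $\alpha$-Reeb graph: given $\alpha>0$ and a covering $\mathcal I=\{I_i\}$ of the range of $d$ by open intervals of length at most $\alpha$, let $\sim_\alpha$ be the transitive closure of the relation ''$d(x)=d(y)$ and $x,y$ lie in the same path-connected component of $d^{-1}(I_i)$ for some $i$''; $G=X/\sim_\alpha$ with quotient map $\pi$. In both cases $d$ induces $d_*:G\to\mathbb R_+$ with $d=d_*\circ\pi$. Metric structure (assuming $G$ is a finite topological graph): the vertex set $V$ consists of the points of degree $\neq 2$, the local maxima of $d_*$, and $\pi(r)$; the edges are the connected components of $G\setminus V$. Each edge is given length equal to the absolute difference of $d_*$ at its endpoints, the distance between two points $p,p'$ of the same edge being $|d_*(p)-d_*(p')|$; $d_G$ is the resulting metric-graph metric. $d_{GH}$ is the Gromov–Hausdorff distance: half the infimum of $\varepsilon\ge0$ such that there is a correspondence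 $C\subset X\times G$ (projecting surjectively onto both factors) with $|d_X(x,x')-d_G(y,y')|\le\varepsilon$ for all $(x,y),(x',y')\in C$.
   Formalization: The formal statement adds the hypothesis M > 0; when M = 0 (for example X = [0,1], r = 0, where G = X and d_GH = 0) the strict inequality would read 0 < 0 and always fails. *)

(* Defs.v *)
From HB Require Import structures.
From mathcomp Require Import all_boot all_order all_algebra.
From mathcomp Require Import all_classical all_reals.
From Stdlib Require Import Relations.
From Stdlib Require List.
Set Implicit Arguments. Unset Strict Implicit. Unset Printing Implicit Defensive.
Import Order.TTheory GRing.Theory Num.Theory.
Local Open Scope ring_scope.
Local Open Scope classical_set_scope.

Section ReebDefs.
Variable R : realType.

Section MetricX.
Variables (X : Type) (dX : X -> X -> R).

Definition is_metric : Prop :=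
  [/\ (forall x y, 0 <= dX x y),
      (forall x y, dX x y = 0 <-> x = y),
      (forall x y, dX x y = dX y x) &
      (forall x y z, dX x z <= dX x y + dX y z)].

Definition mopen (U : set X) : Prop :=
  forall x, U x -> exists e : R, 0 < e /\ forall y, dX x y < e -> U y.

Definition mcompact : Prop :=
  forall (I : Type) (U : I -> set X), (forall i, mopen (U i)) ->
    (forall x, exists i, U i x) ->
    exists s : seq I, forall x, exists2 i, Stdlib.Lists.List.In i s & U i x.

Definition geodesic : Prop :=
  forall x y, exists g : R -> X,
    [/\ g 0 = x, g (dX x y) = y &
        forall s t, 0 <= s <= dX x y -> 0 <= t <= dX x y ->
          dX (g s) (g t) = `|s - t|].

Definition cont01 (g : R -> X) : Prop :=
  forall t, 0 <= t <= 1 -> forall e : R, 0 < e -> exists d : R, 0 < d /\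
    forall s, 0 <= s <= 1 -> `|s - t| < d -> dX (g s) (g t) < e.

Definition same_path_comp (A : set X) (x y : X) : Prop :=
  exists g : R -> X, [/\ g 0 = x, g 1 = y, cont01 g &
    forall t, 0 <= t <= 1 -> A (g t)].

Definition reeb_rel (d : X -> R) (x y : X) : Prop :=
  d x = d y /\ same_path_comp [set z | d z = d x] x y.

Definition alpha_step (d : X -> R) (I : Type) (a b : I -> R) (x y : X) : Prop :=
  d x = d y /\ exists i, same_path_comp [set z | a i < d z < b i] x y.

Definition reeb_or_alpha_reeb (r : X) (eqv : X -> X -> Prop) : Prop :=
  (forall x y, eqv x y <-> reeb_rel (dX r) x y) \/
  exists (alpha : R) (I : Type) (a b : I -> R),
    [/\ 0 < alpha, (forall i, b i - a i <= alpha),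
        (forall x, exists i, a i < dX r x < b i) &
        forall x y, eqv x y <-> clos_trans X (alpha_step (dX r) a b) x y].

Section Quotient.
Variables (G : Type) (pi : X -> G).

Definition is_quotient (eqv : X -> X -> Prop) : Prop :=
  (forall p, exists x, pi x = p) /\ (forall x y, pi x = pi y <-> eqv x y).

Definition Gopen (U : set G) : Prop := mopen (pi @^-1` U).

Definition Gconnected (A : set G) : Prop :=
  forall U W, Gopen U -> Gopen W -> A `<=` U `|` W -> A `&` U `&` W = set0 ->
    A `&` U = set0 \/ A `&` W = set0.

Definition Gcomponent (A : set G) (p : G) : set G :=
  [set q | exists C, [/\ C `<=` A, Gconnected C, C p & C q]].

Definition Gclosure (A : set G) : set G :=
  [set q | forall U, Gopen U -> U q -> A `&` U !=set0].

Definition rel_open01 (A : set R) : Prop :=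
  forall t, 0 <= t <= 1 -> A t -> exists e : R, 0 < e /\
    forall s, 0 <= s <= 1 -> `|s - t| < e -> A s.

(* combinatorial data of a finite graph (multigraph, loops allowed) together
   with a map of its geometric realization into G *)
Record fin_graph := FinGraph {
  nV : nat; nE : nat;
  vtx : 'I_nV -> G;
  src : 'I_nE -> 'I_nV; tgt : 'I_nE -> 'I_nV;
  emap : 'I_nE -> R -> G }.
Arguments vtx : clear implicits.
Arguments src : clear implicits.
Arguments tgt : clear implicits.
Arguments emap : clear implicits.

(* the map from the geometric realization of S to G is a homeomorphism,
   i.e. G "is a finite graph" with structure S *)
Definition is_realization (S : fin_graph) : Prop :=
  injective (vtx S) /\
  [/\ (forall k, emap S k 0 = vtx S (src S k) /\ emap S k 1 = vtx S (tgt S k)),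
      (forall k t, 0 < t < 1 -> forall v, emap S k t <> vtx S v),
      (forall k j s t, 0 < s < 1 -> 0 < t < 1 -> emap S k s = emap S j t ->
          (k = j /\ s = t)),
      (forall p, (exists v, vtx S v = p) \/
                 exists k t, 0 < t < 1 /\ emap S k t = p) &
      (forall k U, Gopen U -> rel_open01 (emap S k @^-1` U))] /\
  (forall U, (forall k, rel_open01 (emap S k @^-1` U)) -> Gopen U).

(* p has degree different from 2: p is a vertex of S with a number of
   incident edge-ends (loops counted twice) different from 2; non-vertex
   points have degree 2 *)
Definition deg_ne2 (S : fin_graph) (p : G) : Prop :=
  exists v, vtx S v = p /\
    (#|[set k | src S k == v]| + #|[set k | tgt S k == v]| != 2)%N.

Definition adj (S : fin_graph) : rel 'I_(nV S) :=
  fun u w => [exists k, ((src S k == u) && (tgt S k == w)) ||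
                        ((src S k == w) && (tgt S k == u))].

Definition betti1 (S : fin_graph) : int :=
  (nE S)%:Z - (nV S)%:Z + (n_comp (@adj S) predT)%:Z.

Variables (r : X) (dstar : G -> R).

Definition local_max (p : G) : Prop :=
  exists U, [/\ Gopen U, U p & forall q, U q -> dstar q <= dstar p].

Definition Vset (S : fin_graph) : set G :=
  [set p | deg_ne2 S p \/ local_max p \/ p = pi r].

Definition same_edge (S : fin_graph) (p q : G) : Prop :=
  exists c, ~ Vset S c /\
    Gclosure (Gcomponent (~` Vset S) c) p /\
    Gclosure (Gcomponent (~` Vset S) c) q.

Definition dG (S : fin_graph) (p q : G) : R :=
  inf [set L | exists (n : nat) (f : nat -> G),
    [/\ f 0%N = p, f n = q,
        (forall i, (i < n)%N -> same_edge S (f i) (f i.+1)) &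
        L = \sum_(i < n) `|dstar (f i) - dstar (f i.+1)|]].

End Quotient.

Definition diam (A : set X) : R :=
  sup [set e | exists x y, [/\ A x, A y & e = dX x y]].

Definition Mfib (G : Type) (pi : X -> G) : R :=
  sup [set m | exists p : G, m = diam (pi @^-1` [set p])].

Definition gh_dist (G : Type) (dGG : G -> G -> R) : R :=
  inf [set eps | 0 <= eps /\ exists C : X -> G -> Prop,
    [/\ (forall x, exists p, C x p), (forall p, exists x, C x p) &
        forall x p x' p', C x p -> C x' p' -> `|dX x x' - dGG p p'| <= eps]] / 2.

End MetricX.
End ReebDefs.

(* Main.v *)
Require Import Defs.
From HB Require Import structures.
From mathcomp Require Import all_boot all_order all_algebra.
From mathcomp Require Import all_classical all_reals.
From mathcomp Require Import topology normedtype derive.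
From mathcomp Require Import lra zify.
Set Implicit Arguments. Unset Strict Implicit. Unset Printing Implicit Defensive.
Import Order.TTheory GRing.Theory Num.Theory numFieldNormedType.Exports.
Local Open Scope ring_scope.
Local Open Scope classical_set_scope.

(** The correspondence is the graph of [pi].  Projecting a geodesic of [X] and
    cutting it at its first and last visits to the vertices gives
    [dG (pi x) (pi y) <= dX x y].

    Conversely, a geodesic from a point to the root [r] projects to a path along
    which [dstar] strictly decreases, so [dstar] has no local minimum besides
    [pi r].  Hence [G] can be subdivided into arcs on which [dstar] is strictly
    monotone, every vertex other than [pi r] has a descending arc, and counting
    arcs by their upper ends shows that at most [betti1] points are branch
    points, i.e. have two descending directions.  Away from branch points the
    descent is unique: all descending geodesics over such a point project to the
    same path, and a walk in [G] avoiding branch points first descends and then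
    ascends, so it lifts to [X] up to one jump inside the fiber over its lowest
    point.  A walk that meets the branch points [w_1, ..., w_j], shortcut between
    the first and the last visit to each, splits into [j + 1] such pieces; with
    one more jump at every [w_i] this costs [2 j + 1] jumps of length at most
    [M].  The distortion is thus at most [(2 betti1 + 1) M < 2 (betti1 + 1) M]. *)

(** * Continuous functions on a segment *)

Section RealLine.
Variable R : realType.
Implicit Types (a b s t e : R) (A : set R) (P : R -> Prop) (f : R -> R).

Definition relopen a b A : Prop :=
  forall t, a <= t <= b -> A t -> exists e, 0 < e /\
    forall s, a <= s <= b -> `|s - t| < e -> A s.

(** Let [m] be the supremum of the [t] such that [P] holds on [[a, t]]. The left clause gives [P m];
    if [m] were below a counterexample, the right clause would extend [P] beyond [m]. *)
Lemma real_induction a b P : P a ->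
  (forall t, a <= t < b -> (forall s, a <= s <= t -> P s) ->
     exists e, 0 < e /\ forall s, t < s <= b -> s < t + e -> P s) ->
  (forall t, a < t <= b -> (forall s, a <= s < t -> P s) -> P t) ->
  forall t, a <= t <= b -> P t.
Proof.
move=> Pa Pr Pl t0 t0ab; apply: contrapT => nP.
pose E := [set t | a <= t <= b /\ forall s, a <= s <= t -> P s].
have Ea : E a.
  split; first by lra.
  by move=> s sa; have -> : s = a by lra.
have supE : has_sup E.
  split; first by exists a.
  by exists b => t [tab _]; lra.
set m := sup E.
have am : a <= m by exact: (ub_le_sup (proj2 supE)).
have mb : m <= b by apply: ge_sup; [exists a | move=> t [tab _]; lra].
have Plt s : a <= s < m -> P s.
  move=> sam; have [] := @sup_adherent _ E (m - s) _ supE; first by lra.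
  move=> u [_ Pu]; rewrite -/m => us; apply: Pu; lra.
have Pm : P m.
  have [->//|am'] := eqVneq m a.
  by apply: Pl => //; rewrite lt_neqAle eq_sym am' am mb.
have Ple s : a <= s <= m -> P s.
  move=> sam; have [->//|sm] := eqVneq s m.
  apply: Plt; have : s < m by rewrite lt_neqAle sm; lra.
  lra.
have [mt0|mt0] := leP t0 m; first by apply: nP; apply: Ple; lra.
have mb' : a <= m < b by lra.
have [e [e0 He]] := Pr _ mb' Ple.
pose u := Num.min (m + e / 2) b.
have um : m < u by rewrite lt_min; lra.
have ub : u <= b by rewrite ge_min lexx orbT.
have ue : u < m + e by rewrite gt_min; lra.
suff Eu : E u by have := ub_le_sup (proj2 supE) Eu; rewrite -/m; lra.
split; first by lra.
move=> s su; have [sm|sm] := leP s m; first by apply: Ple; lra.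
apply: He; lra.
Qed.

Definition cont_on a b f : Prop :=
  forall t, a <= t <= b -> forall e, 0 < e -> exists d : R, 0 < d /\
    forall s, a <= s <= b -> `|s - t| < d -> `|f s - f t| < e.

Lemma cont_on_within a b f : cont_on a b f -> {within `[a, b], continuous f}.
Proof.
move=> cf; apply/subspace_continuousP => t; rewrite /= in_itv /= => tab.
apply/cvgrPdist_lt => e e0; have [d [d0 Hd]] := cf _ tab _ e0.
rewrite near_withinE; near=> s; move=> sab; rewrite distrC; apply: Hd.
  by move: sab; rewrite /= in_itv.
rewrite distrC; near: s; exact: nbhsx_ballx.
Unshelve. all: by end_near.
Qed.

Lemma cont_on_sub a b a' b' f : a <= a' -> b' <= b -> cont_on a b f ->
  cont_on a' b' f.
Proof.
move=> aa bb cf t tab e e0; have [|d [d0 Hd]] := cf t _ e e0; first by lra.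
by exists d; split=> // s sab; apply: Hd; lra.
Qed.

Lemma cont_onN a b f : cont_on a b f -> cont_on a b (\- f).
Proof.
move=> cf t tab e e0; have [d [d0 Hd]] := cf t tab e e0.
by exists d; split=> // s sab sd; rewrite -opprD normrN; apply: Hd.
Qed.

Lemma cont_on_argmax a b f : a <= b -> cont_on a b f ->
  exists2 m, a <= m <= b & forall t, a <= t <= b -> f t <= f m.
Proof.
move=> ab /cont_on_within cf; have [m mab H] := EVT_max ab cf.
by exists m => [|t tab]; [rewrite in_itv in mab | apply: H; rewrite in_itv].
Qed.

Lemma cont_on_ivt a b f v : a <= b -> cont_on a b f ->
  f a <= v <= f b -> exists2 t, a <= t <= b & f t = v.
Proof.
move=> ab /cont_on_within cf /andP[fav vfb].
have [|t tab ftv] := IVT ab cf (v := v).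
  by rewrite ge_min fav /= le_max vfb orbT.
by exists t => //; rewrite in_itv in tab.
Qed.

Definition no_local_min a b f : Prop :=
  forall t, a < t < b -> forall d : R, 0 < d ->
    exists s, [/\ a < s < b, `|s - t| < d & f s < f t].

(** The minimum of [f] on [[s, t]] is attained in the interior: if it is attained at an end, then it
    is attained at [u] too. Such a point contradicts [no_local_min]. *)
Lemma no_dip a b f s u t : cont_on a b f -> no_local_min a b f ->
  a <= s -> s < u -> u < t -> t <= b -> f u <= f s -> f u <= f t -> False.
Proof.
move=> cf nf as_ su ut tb us ut'.
have [||m mst Hm] := @cont_on_argmax s t (\- f).
  - lra.
  - exact/cont_onN/(cont_on_sub _ _ cf).
have {}Hm v : s <= v <= t -> f m <= f v by move=> /Hm /=; lra.
have [w swt Hw] : exists2 w, s < w < t & forall v, s <= v <= t -> f w <= f v.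
  have := Hm u; have [ms|ms] := eqVneq m s.
    by move=> Hu; exists u; [lra | move=> v vst; have := Hm v vst; subst m; lra].
  have [mt|mt] := eqVneq m t.
    by move=> Hu; exists u; [lra | move=> v vst; have := Hm v vst; subst m; lra].
  exists m => //; move: ms mt; rewrite !neq_lt; lra.
have [||v [vab vw fvw]] := nf w _ (Num.min (w - s) (t - w)).
  - lra.
  - rewrite lt_min; lra.
move: vw; rewrite lt_min !ltr_norml => vw.
have := Hw v; lra.
Qed.

(** Take [m] where [f] is maximal. A failure of strict monotonicity on one side of [m] creates a dip
    excluded by [no_dip]; if the failing pair contains [m] itself, the midpoint of the pair is the
    dip. *)
Lemma unimodal a b f : a < b -> cont_on a b f -> no_local_min a b f ->
  exists m, [/\ a <= m <= b,
    (forall s t, a <= s -> s < t -> t <= m -> f s < f t) &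
    (forall s t, m <= s -> s < t -> t <= b -> f t < f s)].
Proof.
move=> ab cf nf; have [|m mab Hm] := @cont_on_argmax a b f _ cf; first lra.
exists m; split=> // s t.
- move=> as_ st tm; rewrite ltNge; apply/negP => ts.
  have [tm'|] := eqVneq t m; last first.
    rewrite neq_lt => tm'.
    by apply: (@no_dip a b f s t m) => //; try lra; apply: Hm; lra.
  subst t; pose u := (s + m) / 2; have := Hm u.
  by move=> Hu; apply: (@no_dip a b f s u m) => //; rewrite /u in Hu *; lra.
- move=> as_ st tm; rewrite ltNge; apply/negP => ts.
  have [tm'|] := eqVneq s m; last first.
    rewrite neq_lt => tm'.
    by apply: (@no_dip a b f m s t) => //; try lra; apply: Hm; lra.
  subst s; pose u := (m + t) / 2; have := Hm u.
  by move=> Hu; apply: (@no_dip a b f m u t) => //; rewrite /u in Hu *; lra.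
Qed.

End RealLine.

(** * Finite graph structures and their subdivisions *)

Section GraphStructures.
Variables (R : realType) (X : Type) (dX : X -> X -> R) (G : Type) (pi : X -> G).
Local Notation Gopen := (Gopen dX pi).
Implicit Types (a b s t e : R) (p q : G) (U : set G).

Definition rcont a b (g : R -> G) : Prop :=
  forall U, Gopen U -> relopen a b (g @^-1` U).

Lemma rcont_sub a b a' b' (g : R -> G) : a <= a' -> b' <= b ->
  rcont a b g -> rcont a' b' g.
Proof.
move=> aa bb cg U oU t tab Ut; have [|e [e0 He]] := cg U oU t _ Ut; first lra.
by exists e; split=> // s sab; apply: He; lra.
Qed.

(* Unlike [fin_graph], edges are parametrized by arbitrary segments, so that an
   edge can be subdivided without reparametrization. *)
Record gstruct := GStruct {
  gV : finType; gE : finType;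
  gvtx : gV -> G;
  gsrc : gE -> gV; gtgt : gE -> gV;
  ga : gE -> R; gb : gE -> R;
  gmap : gE -> R -> G }.

Record is_gstruct (T : gstruct) : Prop := IsGStruct {
  gs_inj : injective (@gvtx T);
  gs_lt : forall k : gE T, ga k < gb k;
  gs_src : forall k : gE T, gmap k (ga k) = gvtx (gsrc k);
  gs_tgt : forall k : gE T, gmap k (gb k) = gvtx (gtgt k);
  gs_int : forall (k : gE T) t (v : gV T), ga k < t < gb k -> gmap k t <> gvtx v;
  gs_disj : forall (k j : gE T) s t, ga k < s < gb k -> ga j < t < gb j ->
    gmap k s = gmap j t -> k = j /\ s = t;
  gs_cover : forall p, (exists v : gV T, gvtx v = p) \/
    exists (k : gE T) t, ga k < t < gb k /\ gmap k t = p;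
  gs_cont : forall k : gE T, rcont (ga k) (gb k) (gmap k);
  gs_open : forall U,
    (forall k : gE T, relopen (ga k) (gb k) (gmap k @^-1` U)) -> Gopen U }.

(** A pair of an edge and a Boolean encodes an edge end, so that a loop contributes two distinct
    ends at its vertex, as in [deg_ne2]. *)
Definition gend (T : gstruct) (x : gE T * bool) : gV T :=
  if x.2 then gtgt x.1 else gsrc x.1.

(** Phrased by coincidences instead of a cardinal, so that it transfers along any injection of edge
    ends. *)
Definition deg_le2 (T : gstruct) (v : gV T) : Prop :=
  forall x y z, gend x = v -> gend y = v -> gend z = v ->
    [\/ x = y, y = z | x = z].

(* The last clause says that [#|gE| - #|gV| = n - m], without subtraction. *)
Record refines (W D : set G) (n m : nat) (T : gstruct) : Prop := Refines {
  rf_struct : is_gstruct T;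
  rf_vtx : forall p, W p -> exists v : gV T, gvtx v = p;
  rf_deg : forall v : gV T, D (gvtx v) -> deg_le2 v;
  rf_card : (#|gE T| + m = n + #|gV T|)%N }.

Lemma refines_sub W W' D n m T : W' `<=` W ->
  refines W D n m T -> refines W' D n m T.
Proof. by move=> WW [? H ? ?]; split=> // p /WW; apply: H. Qed.

Lemma gs_end_or_int (T : gstruct) (k : gE T) t : is_gstruct T ->
  ga k <= t <= gb k ->
  (exists v : gV T, gmap k t = gvtx v) \/ ga k < t < gb k.
Proof.
move=> HT tab; have [->|ta] := eqVneq t (ga k).
  by left; eexists; exact: gs_src.
have [->|tb] := eqVneq t (gb k); first by left; eexists; exact: gs_tgt.
by right; move: ta tb; rewrite !neq_lt; lra.
Qed.

(** Interiors of edges are disjoint and contain no vertex, so this set has an empty preimage on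
    every edge but [k], and an open one on [k]. *)
Lemma open_subarc (T : gstruct) (k : gE T) t e : is_gstruct T ->
  Gopen [set q | exists s, [/\ ga k < s < gb k, `|s - t| < e & gmap k s = q]].
Proof.
move=> HT; apply: (gs_open HT) => j u uab [s [sab st su]].
have [[v vu]|uint] := gs_end_or_int HT uab.
  by exfalso; apply: (gs_int HT sab (v := v)); rewrite su.
have [kj su'] := gs_disj HT sab uint su; subst j u.
exists (Num.min (Num.min (s - ga k) (gb k - s)) (e - `|s - t|)).
split; first by rewrite !lt_min; lra.
move=> v vab; rewrite !lt_min !ltr_norml => vs; exists v; split => //; first lra.
have := ler_norm (s - t); have := ler_norm (- (s - t)); rewrite normrN.
rewrite ltr_norml; lra.
Qed.

(** * Splitting an edge at an interior point *)

Section Split.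
Variables (T : gstruct) (HT : is_gstruct T) (k0 : gE T) (t0 : R).
Hypothesis t0int : ga k0 < t0 < gb k0.

(** [None] is both the new vertex and the new edge over [[t0, gb k0]], while [Some k0] keeps
    [[ga k0, t0]]. In either case [odflt k0] recovers the edge of [T] that contains the given
    one. *)
Definition split_struct : gstruct :=
  @GStruct (option (gV T)) (option (gE T)) (oapp (@gvtx T) (gmap k0 t0))
    (omap (@gsrc T))
    (fun k => if k is Some k then if k == k0 then None else Some (gtgt k)
              else Some (gtgt k0))
    (oapp (@ga T) t0)
    (fun k => if k is Some k then if k == k0 then t0 else gb k else gb k0)
    (fun k => gmap (odflt k0 k)).

Lemma split_sub (k : gE split_struct) :
  ga (odflt k0 k) <= ga k /\ gb k <= gb (odflt k0 k).
Proof.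
have t0i := t0int.
by case: k => [k|] /=; [case: eqP => /= [->|_]|]; split=> //; lra.
Qed.

Lemma split_int (k : gE split_struct) t : ga k < t < gb k ->
  ga (odflt k0 k) < t < gb (odflt k0 k).
Proof. by have := split_sub k; lra. Qed.

Lemma split_is_gstruct : is_gstruct split_struct.
Proof.
have t0i := t0int.
split.
- move=> [v|] [w|] //= => [/(gs_inj HT) ->//|h|h].
    by case: (gs_int HT t0int (v := v)).
  by case: (gs_int HT t0int (v := w)).
- case=> [k|] /=; last by lra.
  by case: eqP => /= [->|_]; [lra | exact: gs_lt].
- by case=> [k|] //=; exact: gs_src.
- by case=> [k|] /=; [case: eqP => [->//|_] /=|]; apply: gs_tgt.
- move=> k t [v|] tint /=; first exact/gs_int/split_int.
  move=> h; have [kk tt0] := gs_disj HT (split_int tint) t0int h.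
  by subst t; case: k kk tint {h} => [k|] /= => [->|_]; rewrite ?eqxx; lra.
- move=> k j s t sint tint h.
  have [kj st] := gs_disj HT (split_int sint) (split_int tint) h.
  split=> //; subst t; case: k j kj sint tint {h} => [k|] [j|] //= kj.
  + by rewrite kj.
  + by rewrite kj eqxx => ? ?; exfalso; lra.
  + by rewrite -kj eqxx => ? ?; exfalso; lra.
- move=> p; have [[v <-]|[k [t [tint <-]]]] := gs_cover HT p.
    by left; exists (Some v).
  have [kk|kk] := eqVneq k k0; last first.
    by right; exists (Some k), t => /=; rewrite (negbTE kk).
  subst k; have [tt|] := eqVneq t t0; first by left; exists None; rewrite tt.
  rewrite neq_lt => /orP[tt|tt]; right.
    by exists (Some k0), t; rewrite /= eqxx; split=> //; lra.
  by exists None, t; split=> //=; lra.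
- move=> k; have [ka kb] := split_sub k.
  exact (rcont_sub ka kb (@gs_cont _ HT (odflt k0 k))).
- move=> U HU; apply: (gs_open HT) => k t tab Ut.
  have [kk|kk] := eqVneq k k0; last first.
    by have := HU (Some k) t; rewrite /= (negbTE kk); apply.
  subst k; have := HU (Some k0) t; have := HU None t; rewrite /= eqxx.
  case: (ltgtP t t0) => tt0 H1 H2.
  + have [|//|e [e0 He]] := H2; first lra.
    exists (Num.min e (t0 - t)); rewrite lt_min; split; first lra.
    move=> s sab; rewrite lt_min !ltr_norml => /andP[h1 h2].
    by apply: He; [lra | rewrite ltr_norml].
  + have [|//|e [e0 He]] := H1; first lra.
    exists (Num.min e (t - t0)); rewrite lt_min; split; first lra.
    move=> s sab; rewrite lt_min !ltr_norml => /andP[h1 h2].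
    by apply: He; [lra | rewrite ltr_norml].
  + subst t; have [|//|e [e0 He]] := H1; first lra.
    have [|//|e' [e0' He']] := H2; first lra.
    exists (Num.min e e'); rewrite lt_min; split; first lra.
    move=> s sab; rewrite lt_min => /andP[h1 h2].
    by have [st|st] := leP s t0; [apply: He' | apply: He] => //; lra.
Qed.

Lemma split_refines W D n m : refines W D n m T ->
  refines (W `|` [set gmap k0 t0]) D n m split_struct.
Proof.
case=> _ Wv Dd card; split.
- exact: split_is_gstruct.
- by move=> p [/Wv[v <-]|->]; [exists (Some v) | exists None].
- case=> [v|] /= Dv x y z; last first.
    have H (u : gE split_struct * bool) : gend u = None -> u = (Some k0, true) \/ u = (None, false).
      case: u => [[u|] []]; rewrite /gend //=; last by right.
      by case: eqP => // ->; left.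
    move=> /H hx /H hy /H hz.
    case: hx hy hz => -> [] -> [] ->;
      by [apply: Or31 | apply: Or32 | apply: Or33].
  (* The half of [k0] ending at its old target is represented by [None]. *)
  pose g (x : gE split_struct * bool) : gE T * bool := (odflt k0 x.1, x.2).
  have gv (u : gE split_struct * bool) : gend u = Some v -> gend (g u) = v.
    by case: u => [[u|] []]; rewrite /gend //=; [case: eqP => // _ | |]; case.
  have gi (u w : gE split_struct * bool) : gend u = Some v -> gend w = Some v -> g u = g w -> u = w.
    case: u w => [[u|] bu] [[w|] bw] hu hw gg;
      have /= h := congr1 fst gg; have /= hb := congr1 snd gg; subst bw; move=> {gg} //.
    - by rewrite h.
    - by case: bu hu hw; rewrite /gend /= ?h ?eqxx.
    - by case: bu hu hw; rewrite /gend /= -?h ?eqxx.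
  move=> hx hy hz; have [h|h|h] := Dd v Dv _ _ _ (gv _ hx) (gv _ hy) (gv _ hz).
  + by apply: Or31; apply: gi.
  + by apply: Or32; apply: gi.
  + by apply: Or33; apply: gi.
- by rewrite /= !card_option; lia.
Qed.

End Split.

End GraphStructures.

(** * Subdivision into arcs parametrized by height *)

Section SegmentHomeo.
Variable R : realType.
Implicit Types (a b s t e lo hi : R) (f : R -> R).

(** The field [sh_cinv] is continuity of the inverse; continuity of [f] is supplied separately by
    [edge_cont]. *)
Record seg_homeo a b f lo hi : Prop := SegHomeo {
  sh_range : forall t, a <= t <= b -> lo <= f t <= hi;
  sh_int : forall t, a < t < b -> lo < f t < hi;
  sh_surj : forall h, lo <= h <= hi -> exists2 t, a <= t <= b & f t = h;
  sh_inj : forall s t, a <= s <= b -> a <= t <= b -> f s = f t -> s = t;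
  sh_cinv : forall t, a <= t <= b -> forall d : R, 0 < d -> exists e, 0 < e /\
    forall s, a <= s <= b -> `|f s - f t| < e -> `|s - t| < d }.

Lemma incr_seg_homeo a b f : a < b -> cont_on a b f ->
  (forall s t, a <= s -> s < t -> t <= b -> f s < f t) ->
  seg_homeo a b f (f a) (f b).
Proof.
move=> ab cf inc.
have incw s t : a <= s -> s <= t -> t <= b -> f s <= f t.
  move=> as_; rewrite le_eqVlt => /predU1P[->//|st] tb.
  exact/ltW/inc.
split.
- by move=> t tab; apply/andP; split; apply: incw; lra.
- by move=> t tab; apply/andP; split; apply: inc; lra.
- by move=> h hab; apply: cont_on_ivt => //; exact: ltW.
- move=> s t sab tab fst; case: (ltgtP s t) => // st.
    have : f s < f t by apply: inc; lra.
    lra.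
  have : f t < f s by apply: inc; lra.
  lra.
- move=> t tab d d0.
  (* [e1] and [e2] are the changes of [f] over distance [d] on the two sides of [t]. If [t + d] or
     [t - d] leaves the segment, no point on that side is that far away and any positive value will
     do. *)
  pose e1 := if t + d <= b then f (t + d) - f t else 1.
  pose e2 := if a <= t - d then f t - f (t - d) else 1.
  have e10 : 0 < e1.
    rewrite /e1; case: ifP => // h; rewrite subr_gt0; apply: inc; lra.
  have e20 : 0 < e2.
    rewrite /e2; case: ifP => // h; rewrite subr_gt0; apply: inc; lra.
  exists (Num.min e1 e2); split; first by rewrite lt_min e10.
  move=> s sab; rewrite lt_min !ltr_norml => /andP[h1 h2].
  apply/andP; split; rewrite ltNge; apply/negP => h.
    have td : a <= t - d by lra.
    have := incw s (t - d); move: h2; rewrite /e2 td; lra.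
  have td : t + d <= b by lra.
  have := incw (t + d) s; move: h1; rewrite /e1 td; lra.
Qed.

Lemma decr_seg_homeo a b f : a < b -> cont_on a b f ->
  (forall s t, a <= s -> s < t -> t <= b -> f t < f s) ->
  seg_homeo a b f (f b) (f a).
Proof.
move=> ab cf dec.
have [|h1 h2 h3 h4 h5] := incr_seg_homeo ab (cont_onN cf).
  by move=> s t as_ st tb; rewrite ltrN2; exact: dec.
split.
- by move=> t /h1 /=; rewrite !lerN2 andbC.
- by move=> t /h2 /=; rewrite !ltrN2 andbC.
- move=> h hab; have [|t tab fth] := h3 (- h); first by rewrite /= !lerN2 andbC.
  by exists t => //; apply: oppr_inj.
- by move=> s t sab tab fst; apply: h4 => //=; rewrite fst.
- move=> t tab d d0; have [e [e0 He]] := h5 t tab d d0.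
  exists e; split=> // s sab st; apply: He => //=.
  by rewrite -opprD normrN.
Qed.

End SegmentHomeo.

Section Monotone.
Variables (R : realType) (X : Type) (dX : X -> X -> R) (G : Type) (pi : X -> G).
Variables (dstar : G -> R) (rho : G).
Local Notation Gopen := (Gopen dX pi).
Local Notation gstruct := (gstruct R G).
Local Notation is_gstruct := (is_gstruct dX pi).
Local Notation refines := (refines dX pi).
Hypothesis dstar_open : forall c e : R, Gopen [set q | `|dstar q - c| < e].
Hypothesis lower_point : forall p U, p <> rho -> Gopen U -> U p ->
  exists2 q, U q & dstar q < dstar p.
Implicit Type T : gstruct.

Definition edge_incr T (k : gE T) : Prop :=
  forall s t, ga k <= s -> s < t -> t <= gb k ->
    dstar (gmap k s) < dstar (gmap k t).

Definition edge_decr T (k : gE T) : Prop :=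
  forall s t, ga k <= s -> s < t -> t <= gb k ->
    dstar (gmap k t) < dstar (gmap k s).

Definition edge_mono T (k : gE T) : Prop := edge_incr k \/ edge_decr k.

Lemma edge_cont T (k : gE T) : is_gstruct T ->
  cont_on (ga k) (gb k) (dstar \o gmap k).
Proof.
move=> HT t tab e e0.
have [|d [d0 Hd]] := gs_cont HT (@dstar_open (dstar (gmap k t)) e) tab.
  by rewrite /= subrr normr0.
by exists d.
Qed.

(** Small subarcs are open in [G], so the lower point given by [lower_point] lies on the same edge,
    near [t]. *)
Lemma edge_no_local_min T (k : gE T) : is_gstruct T ->
  (exists v : gV T, gvtx v = rho) ->
  no_local_min (ga k) (gb k) (dstar \o gmap k).
Proof.
move=> HT [v vrho] t tab d d0.
have pr : gmap k t <> rho by rewrite -vrho; exact: (gs_int HT).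
have [|q [s [sab st <-]] lt] := lower_point pr (@open_subarc _ _ _ _ _ T k t d HT).
  by exists t; rewrite subrr normr0.
by exists s.
Qed.

(** Induction on the number of non-monotone edges: by [unimodal] such an edge rises to a single peak
    and then falls, so splitting it at the peak yields two monotone edges. *)
Lemma exists_mono_refinement W D n m T : W rho -> refines W D n m T ->
  exists2 T', refines W D n m T' & forall k : gE T', edge_mono k.
Proof.
move=> Wrho; pose bad T := [set k : gE T | `[< ~ edge_mono k >]]%SET.
have [N] := ubnP #|bad T|; elim: N T => // N IH T ltN RT.
have [/set0Pn[k0]|b0] := boolP (bad T != finset.set0); last first.
  exists T => // k; apply: contrapT => nk; move: b0; rewrite negbK => /eqP b0.
  have : k \in bad T by rewrite inE; apply/asboolP.
  by rewrite b0 inE.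
rewrite inE => /asboolP nmono.
have HT := rf_struct RT.
have [c [cab inc dec]] := unimodal (gs_lt HT k0) (@edge_cont _ k0 HT)
  (@edge_no_local_min _ k0 HT (rf_vtx RT Wrho)).
have ca : ga k0 < c.
  rewrite lt_neqAle; apply/andP; split; last lra.
  apply/eqP => ca; apply: nmono; right => s t sa st tb; apply: dec => //.
  by rewrite -ca.
have cb : c < gb k0.
  rewrite lt_neqAle; apply/andP; split; last lra.
  apply/eqP => cb; apply: nmono; left => s t sa st tb; apply: inc => //.
  by rewrite cb.
have cint : ga k0 < c < gb k0 by rewrite ca.
have RT' := split_refines HT cint RT.
apply: (IH (split_struct k0 c)); last by apply: refines_sub RT'; left.
rewrite ltnS in ltN; apply: leq_trans ltN.
have kbad : k0 \in bad T by rewrite inE; apply/asboolP.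
rewrite (cardsD1 k0 (bad T)) kbad add1n ltnS -(card_imset (mem (bad T :\ k0)%SET) (@Some_inj _)).
apply: subset_leq_card; apply/fintype.subsetP => k; rewrite inE => /asboolP nk.
apply/imsetP; case: k nk => [k|] nk; last first.
  by exfalso; apply: nk; right.
have [kk|kk] := eqVneq k k0.
  by exfalso; apply: nk; left => s t /=; rewrite kk eqxx; exact: inc.
exists k => //; rewrite !inE kk /=; apply/asboolP => mk; apply: nk.
by case: mk => h; [left|right] => s t /=; rewrite (negbTE kk); exact: h.
Qed.

(* In a height structure an edge is parametrized by the value of [dstar], so
   [gsrc] is its lower and [gtgt] its upper end. *)
Definition height_param T : Prop :=
  forall (k : gE T) h, ga k <= h <= gb k -> dstar (gmap k h) = h.

(** * Reparametrizing monotone edges by height *)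

Section Reparam.
Variables (T : gstruct) (HT : is_gstruct T).
Hypothesis mono : forall k : gE T, edge_mono k.

Let up (k : gE T) : bool := `[< edge_incr k >].
Let lo (k : gE T) := if up k then gsrc k else gtgt k.
Let hi (k : gE T) := if up k then gtgt k else gsrc k.
(** The default [ga k] is returned only for heights that the edge does not reach. *)
Let inv (k : gE T) (h : R) : R :=
  xget (ga k) [set t | ga k <= t <= gb k /\ dstar (gmap k t) = h].

Definition height_struct : gstruct :=
  @GStruct R G (gV T) (gE T) (@gvtx _ _ T) lo hi
    (fun k => dstar (gvtx (lo k))) (fun k => dstar (gvtx (hi k)))
    (fun k h => gmap k (inv k h)).

Let sh (k : gE T) : seg_homeo (ga k) (gb k) (dstar \o gmap k)
  (dstar (gvtx (lo k))) (dstar (gvtx (hi k))).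
Proof.
rewrite /lo /hi /up; case: asboolP => h; rewrite -(gs_src HT) -(gs_tgt HT).
  apply: (incr_seg_homeo (gs_lt HT k) (@edge_cont _ k HT)); exact: h.
case: (mono k) => // h'.
apply: (decr_seg_homeo (gs_lt HT k) (@edge_cont _ k HT)); exact: h'.
Qed.

Let invP (k : gE T) h : dstar (gvtx (lo k)) <= h <= dstar (gvtx (hi k)) ->
  ga k <= inv k h <= gb k /\ dstar (gmap k (inv k h)) = h.
Proof.
move=> /(sh_surj (sh k))[t tab fth].
by rewrite /inv; case: xgetP => [s -> //|/(_ t)]; case.
Qed.

Let invK (k : gE T) t : ga k <= t <= gb k -> inv k (dstar (gmap k t)) = t.
Proof.
move=> tab; have [|h1 h2] := @invP k (dstar (gmap k t)).
  exact: (sh_range (sh k)).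
exact: (sh_inj (sh k)).
Qed.

Let inv_int (k : gE T) h : dstar (gvtx (lo k)) < h < dstar (gvtx (hi k)) ->
  ga k < inv k h < gb k.
Proof.
move=> hint; have [|iab fi] := @invP k h; first lra.
have [E|ia] := eqVneq (inv k h) (ga k).
  move: fi hint; rewrite E (gs_src HT) /lo /hi; case: (up k); lra.
have [E|ib] := eqVneq (inv k h) (gb k).
  move: fi hint; rewrite E (gs_tgt HT) /lo /hi; case: (up k); lra.
move: ia ib; rewrite !neq_lt; lra.
Qed.

Lemma height_structP : height_param height_struct.
Proof. by move=> k h /invP[]. Qed.

Lemma height_is_gstruct : is_gstruct height_struct.
Proof.
have lt k := gs_lt HT k.
split=> //=.
- exact: gs_inj HT.
- move=> k; have lk := lt k.
  have /(sh_int (sh k)) : ga k < (ga k + gb k) / 2 < gb k by lra.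
  lra.
- move=> k; have lk := lt k; rewrite /lo; case: (up k).
    by rewrite -(gs_src HT) invK //; lra.
  by rewrite -(gs_tgt HT) invK //; lra.
- move=> k; have lk := lt k; rewrite /hi; case: (up k).
    by rewrite -(gs_tgt HT) invK //; lra.
  by rewrite -(gs_src HT) invK //; lra.
- by move=> k t v /inv_int; exact: (gs_int HT).
- move=> k j s t si ti h.
  have [kj st] := gs_disj HT (inv_int si) (inv_int ti) h; split=> //.
  have [|_ <-] := @invP k s; first lra.
  have [|_ <-] := @invP j t; first lra.
  by rewrite h.
- move=> p; have [|[k [t [tab <-]]]] := gs_cover HT p; first by left.
  right; exists k, (dstar (gmap k t)); split; first exact: (sh_int (sh k)).
  by rewrite invK //; lra.
- move=> k U oU h hab Uh; have [iab fi] := invP hab.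
  have [d [d0 Hd]] := gs_cont HT oU iab Uh.
  have [e [e0 He]] := sh_cinv (sh k) iab d0.
  exists e; split=> // h' hab' hh; have [iab' fi'] := invP hab'.
  by apply: Hd => //; apply: He => //=; rewrite fi fi'.
- move=> U HU; apply: (gs_open HT) => k t tab Ut.
  have [||e [e0 He]] := HU k (dstar (gmap k t)).
  + exact: (sh_range (sh k)).
  + by rewrite /= invK.
  have [d [d0 Hd]] := @edge_cont _ k HT _ tab _ e0.
  exists d; split=> // s sab st.
  have := He (dstar (gmap k s)); rewrite /= invK //; apply.
    exact: (sh_range (sh k)).
  exact: Hd.
Qed.

(** Only the decreasing edges are reversed, which permutes the edge ends: [g] flips the Boolean
    exactly on those edges. *)
Lemma height_refines W D n m : refines W D n m T ->
  refines W D n m height_struct.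
Proof.
case=> _ Wv Dd card; split=> //; first exact: height_is_gstruct.
move=> v Dv x y z.
pose g (x : gE T * bool) := (x.1, x.2 == up x.1).
have gg (u : gE T * bool) : @gend _ _ height_struct u = gend (g u).
  by case: u => [u []]; rewrite /gend /g /= /lo /hi; case: (up u).
have gi (u w : gE T * bool) : g u = g w -> u = w.
  case: u w => [u bu] [w bw] E; have /= h := congr1 fst E.
  have /= hb := congr1 snd E; subst w; congr pair; move: hb {E}.
  by case: (up u) bu bw => [] [] [].
rewrite !gg => hx hy hz; have [h|h|h] := Dd v Dv _ _ _ hx hy hz.
- by apply: Or31; apply: gi.
- by apply: Or32; apply: gi.
- by apply: Or33; apply: gi.
Qed.

End Reparam.

End Monotone.

(** * Star neighborhoods and branch points *)

Lemma finite_lower_bound (R : realType) (I : finType) (f : I -> R) :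
  (forall i, 0 < f i) -> exists2 d : R, 0 < d & forall i, d <= f i.
Proof.
move=> f0; exists (\big[Order.min/1]_i f i).
  by apply: lt_bigmin => //; exact: ltr01.
by move=> i; apply: bigmin_le_cond.
Qed.

Section Gtopology.
Variables (R : realType) (X : Type) (dX : X -> X -> R) (G : Type) (pi : X -> G).
Local Notation Gopen := (Gopen dX pi).

Lemma GopenI U W : Gopen U -> Gopen W -> Gopen (U `&` W).
Proof.
move=> oU oW x [Ux Wx]; have [e [e0 He]] := oU x Ux.
have [e' [e0' He']] := oW x Wx; exists (Num.min e e').
rewrite lt_min e0 e0'; split=> // y; rewrite lt_min => /andP[ye ye'].
by split; [exact: He | exact: He'].
Qed.

(** For [phi = dstar]: at most one descending direction at [p]. For the opposite of [dstar]: at most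
    one ascending direction. *)
Definition non_branch (phi : G -> R) (p : G) : Prop :=
  exists U, [/\ Gopen U, U p & forall q q', U q -> U q' -> phi q = phi q' ->
    phi q < phi p -> q = q'].

Definition Ghausdorff : Prop := forall p q : G, p <> q ->
  exists U W, [/\ Gopen U, Gopen W, U p, W q & forall z, U z -> W z -> False].

End Gtopology.

Section HeightStructure.
Variables (R : realType) (X : Type) (dX : X -> X -> R) (G : Type) (pi : X -> G).
Variables (dstar : G -> R) (rho : G).
Local Notation Gopen := (Gopen dX pi).
Local Notation non_branch := (non_branch dX pi).
Hypothesis dstar_open : forall c e : R, Gopen [set q | `|dstar q - c| < e].
Hypothesis lower_point : forall p U, p <> rho -> Gopen U -> U p ->
  exists2 q, U q & dstar q < dstar p.
Hypothesis rho_min : forall q, dstar rho <= dstar q.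
Variables (T : gstruct R G) (HT : is_gstruct dX pi T).
Hypothesis hp : height_param dstar T.
Implicit Types (p q : G) (k j : gE T) (v : gV T) (d h : R).

Lemma height_gap p : exists2 d, 0 < d &
  forall v, dstar (gvtx v) <> dstar p -> d <= `|dstar (gvtx v) - dstar p|.
Proof.
have [|d d0 Hd] := @finite_lower_bound R (gV T) (fun v =>
  if dstar (gvtx v) == dstar p then 1 else `|dstar (gvtx v) - dstar p|).
  by move=> v; case: eqP => // /eqP ne; rewrite normr_gt0 subr_eq0.
by exists d => // v /eqP/negbTE ne; have := Hd v; rewrite ne.
Qed.

(** In a height structure an edge passes through [p] at most once, at parameter [dstar p]. The point
    [p] is listed separately to allow a vertex without edges. *)
Definition star p d : set G := [set q | q = p \/ exists k h,
  [/\ ga k <= h <= gb k, ga k <= dstar p <= gb k, gmap k (dstar p) = p,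
      `|h - dstar p| < d & gmap k h = q]].

Definition star_radius p d : Prop := 0 < d /\
  forall v, dstar (gvtx v) <> dstar p -> d <= `|dstar (gvtx v) - dstar p|.

Lemma nonvertex_height p d k h : star_radius p d -> ga k <= h <= gb k ->
  `|h - dstar p| < d -> h <> dstar p -> ga k < h < gb k.
Proof.
move=> [d0 Hd] hab hd hp0.
have [[v Ev]|//] := gs_end_or_int HT hab.
have Eh : dstar (gvtx v) = h by rewrite -Ev hp.
by have := Hd v; rewrite Eh => /(_ hp0); rewrite leNgt hd.
Qed.

(** The radius is at most the height gap to every vertex at another height, so a point of the star
    other than [p] is interior to an edge and is met by no other edge. *)
Lemma star_open p d : star_radius p d -> Gopen (star p d).
Proof.
move=> rd; have d0 := rd.1; apply: (gs_open HT) => j u uab.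
have [up|up] := pselect (gmap j u = p).
  move=> _; have uh : u = dstar p by rewrite -up hp.
  exists d; split=> // s sab sd; right; exists j, s.
  by split=> //; rewrite -?uh.
case=> [//|[k [h [hab pab kp hd ku]]]].
have hu : h = u by rewrite -(hp hab) ku hp.
subst u; have ne : h <> dstar p by move=> E; apply: up; rewrite -ku E.
have hi := nonvertex_height rd hab hd ne.
have ui := nonvertex_height rd uab hd ne.
have [kj _] := gs_disj HT hi ui ku; subst j.
exists (d - `|h - dstar p|); split; first lra.
move=> s sab sh; right; exists k, s; split=> //.
rewrite -(subrK h s) -addrA; apply: le_lt_trans (ler_normD _ _) _; lra.
Qed.

Lemma star_center p d : star p d p. Proof. by left. Qed.

Lemma star_dist p d q : star_radius p d -> star p d q ->
  `|dstar q - dstar p| < d.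
Proof.
move=> [d0 _] [->|[k [h [hab _ _ hd <-]]]]; first by rewrite subrr normr0.
by rewrite hp.
Qed.

Lemma star_below p d q : star p d q -> dstar q < dstar p ->
  exists k, [/\ ga k <= dstar q, dstar p <= gb k, gmap k (dstar p) = p &
    gmap k (dstar q) = q].
Proof.
move=> [->|[k [h [hab pab kp hd <-]]]]; first by rewrite ltxx.
by rewrite hp // => lt; exists k; split=> //; lra.
Qed.

Lemma star_above p d q : star p d q -> dstar p < dstar q ->
  exists k, [/\ ga k <= dstar p, dstar q <= gb k, gmap k (dstar p) = p &
    gmap k (dstar q) = q].
Proof.
move=> [->|[k [h [hab pab kp hd <-]]]]; first by rewrite ltxx.
by rewrite hp // => lt; exists k; split=> //; lra.
Qed.

Lemma star_same_height p d q : star p d q -> dstar q = dstar p -> q = p.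
Proof.
move=> [//|[k [h [hab pab kp hd <-]]]].
by rewrite hp // => ->.
Qed.

Lemma star_off_vertex p d q v : star_radius p d -> star p d q -> q <> p ->
  gvtx v <> q.
Proof.
move=> rd sq qp; have ne : dstar q <> dstar p.
  by move=> /(star_same_height sq).
case: sq => [//|[k [h [hab pab kp hd Eq]]]] Ev.
move: ne; rewrite -Eq hp // => ne.
by apply: (gs_int HT (nonvertex_height rd hab hd ne) (v := v)); rewrite Eq.
Qed.

(** Points of different heights are separated by height bands. For equal heights, a common point of
    the two stars would be interior to one edge passing through both [p] and [q] at that height. *)
Lemma G_hausdorff : Ghausdorff dX pi.
Proof.
move=> p q pq; have [E|/eqP ne] := eqVneq (dstar p) (dstar q); last first.
  pose e := `|dstar p - dstar q| / 2.
  exists [set z | `|dstar z - dstar p| < e], [set z | `|dstar z - dstar q| < e].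
  have e0 : 0 < e by rewrite divr_gt0 // normr_gt0 subr_eq0; apply/eqP.
  split; rewrite /= ?subrr ?normr0 //.
  move=> z h1 h2; have := ler_normD (dstar p - dstar z) (dstar z - dstar q).
  rewrite addrA subrK (distrC (dstar p) (dstar z)); rewrite /e in h1 h2; lra.
have [d1 d10 H1] := height_gap p; have [d2 d20 H2] := height_gap q.
exists (star p d1), (star q d2); split; try exact: star_center.
- exact: star_open.
- exact: star_open.
move=> z z1 z2; have [zp|/eqP zp] := eqVneq (dstar z) (dstar p).
  apply: pq; rewrite -(star_same_height z1 zp) (star_same_height z2) //.
  by rewrite zp.
case: z1 => [z1|]; first by rewrite z1 in zp.
case=> k [h [hab pab kp hd kz]].
case: z2 => [z2|]; first by rewrite z2 E in zp.
case=> j [h' [hab' qab jq hd' jz]].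
have hh : h = h' by rewrite -(hp hab) kz -jz hp.
subst h'; have ne : h <> dstar p by rewrite -(hp hab) kz.
have hi : ga k < h < gb k by apply: (@nonvertex_height p d1).
have hi' : ga j < h < gb j.
  by apply: (@nonvertex_height q d2) => //; rewrite -E.
have [kj _] := gs_disj HT hi hi' (etrans kz (esym jz)); subst j.
by apply: pq; rewrite -kp -jq E.
Qed.

Lemma edge_top k v : ga k < dstar (gvtx v) -> dstar (gvtx v) <= gb k ->
  gmap k (dstar (gvtx v)) = gvtx v -> gtgt k = v.
Proof.
move=> h1 h2 E; have [Eb|nb] := eqVneq (dstar (gvtx v)) (gb k).
  by apply: (gs_inj HT); rewrite -E Eb (gs_tgt HT).
exfalso; apply: (gs_int HT _ E); rewrite h1 /= lt_neqAle nb; lra.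
Qed.

Lemma edge_bottom k v : ga k <= dstar (gvtx v) -> dstar (gvtx v) < gb k ->
  gmap k (dstar (gvtx v)) = gvtx v -> gsrc k = v.
Proof.
move=> h1 h2 E; have [Eb|nb] := eqVneq (ga k) (dstar (gvtx v)).
  by apply: (gs_inj HT); rewrite -E -Eb (gs_src HT).
exfalso; apply: (gs_int HT _ E); rewrite h2 andbT lt_neqAle nb; lra.
Qed.

(** Within the star, each point below [gvtx v] lies on an edge with upper end [v]; a unique such
    edge leaves one point per height. *)
Lemma non_branch_down v :
  (forall k j, gtgt k = v -> gtgt j = v -> k = j) -> non_branch dstar (gvtx v).
Proof.
move=> uniq_k; have [d d0 Hd] := height_gap (gvtx v).
exists (star (gvtx v) d); split; [exact: star_open | exact: star_center |].
move=> q q' sq sq' E lt.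
have [k [k1 k2 k3 <-]] := star_below sq lt.
have [|j [j1 j2 j3 <-]] := star_below sq'; first by rewrite -E.
rewrite -E (uniq_k k j) //; apply: edge_top => //; lra.
Qed.

Lemma non_branch_up v :
  (forall k j, gsrc k = v -> gsrc j = v -> k = j) ->
  non_branch (\- dstar) (gvtx v).
Proof.
move=> uniq_k; have [d d0 Hd] := height_gap (gvtx v).
exists (star (gvtx v) d); split; [exact: star_open | exact: star_center |].
move=> q q' sq sq' /= /oppr_inj E; rewrite ltrN2 => lt.
have [k [k1 k2 k3 <-]] := star_above sq lt.
have [|j [j1 j2 j3 <-]] := star_above sq'; first by rewrite -E.
rewrite -E (uniq_k k j) //; apply: edge_bottom => //; lra.
Qed.

Lemma edge_through k p : (forall v, gvtx v <> p) -> ga k <= dstar p <= gb k ->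
  gmap k (dstar p) = p -> ga k < dstar p < gb k.
Proof.
move=> np pab kp; have [[v Ev]|//] := gs_end_or_int HT pab.
by case: (np v); rewrite -Ev.
Qed.

Lemma non_branch_interior p : (forall v, gvtx v <> p) ->
  non_branch dstar p /\ non_branch (\- dstar) p.
Proof.
move=> np; have [d d0 Hd] := height_gap p.
split; exists (star p d); (split; [exact: star_open | exact: star_center |]).
- move=> q q' sq sq' E lt.
  have [k [k1 k2 k3 <-]] := star_below sq lt.
  have [|j [j1 j2 j3 <-]] := star_below sq'; first by rewrite -E.
  have ki : ga k < dstar p < gb k by apply: edge_through => //; lra.
  have ji : ga j < dstar p < gb j by apply: edge_through => //; lra.
  by have [-> _] := gs_disj HT ki ji (etrans k3 (esym j3)); rewrite E.
- move=> q q' sq sq' /= /oppr_inj E; rewrite ltrN2 => lt.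
  have [k [k1 k2 k3 <-]] := star_above sq lt.
  have [|j [j1 j2 j3 <-]] := star_above sq'; first by rewrite -E.
  have ki : ga k < dstar p < gb k by apply: edge_through => //; lra.
  have ji : ga j < dstar p < gb j by apply: edge_through => //; lra.
  by have [-> _] := gs_disj HT ki ji (etrans k3 (esym j3)); rewrite E.
Qed.

Lemma exists_down_edge v : gvtx v <> rho -> exists k, gtgt k = v.
Proof.
move=> vr; have [d d0 Hd] := height_gap (gvtx v).
have [q sq lt] := lower_point vr (@star_open _ d (conj d0 Hd)) (star_center _ _).
have [k [k1 k2 k3 k4]] := star_below sq lt.
by exists k; apply: edge_top => //; lra.
Qed.

Lemma exists_up_edge v : ~ local_max dX pi dstar (gvtx v) ->
  exists k, gsrc k = v.
Proof.
move=> nmax; have [d d0 Hd] := height_gap (gvtx v).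
have [q sq lt] : exists2 q, star (gvtx v) d q & dstar (gvtx v) < dstar q.
  apply: contrapT => H; apply: nmax; exists (star (gvtx v) d).
  split; [exact: star_open | exact: star_center |].
  by move=> q sq; rewrite leNgt; apply/negP => lt; apply: H; exists q.
have [k [k1 k2 k3 k4]] := star_above sq lt.
by exists k; apply: edge_bottom => //; lra.
Qed.

(** From an interior point of an edge one can move up along the edge. *)
Lemma local_max_vertex p : local_max dX pi dstar p -> exists v, gvtx v = p.
Proof.
move=> [U [oU Up Hmax]]; have [//|[k [t [tab kp]]]] := gs_cover HT p.
have [||e [e0 He]] := gs_cont HT oU (k := k) (t := t); first lra.
  by rewrite /= kp.
pose s := t + Num.min (e / 2) ((gb k - t) / 2).
have m0 : 0 < Num.min (e / 2) ((gb k - t) / 2) by rewrite lt_min; lra.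
have me : Num.min (e / 2) ((gb k - t) / 2) <= e / 2 by rewrite ge_min lexx.
have mb : Num.min (e / 2) ((gb k - t) / 2) <= (gb k - t) / 2.
  by rewrite ge_min lexx orbT.
have sab : ga k <= s <= gb k by rewrite /s; lra.
have /Hmax : U (gmap k s).
  by apply: He => //; rewrite /s addrC addKr gtr0_norm //; lra.
by rewrite -kp !hp; [rewrite /s; lra | lra | lra].
Qed.

Definition branch_vertices : {set gV T} :=
  [set v | `[< ~ non_branch dstar (gvtx v) >]]%SET.

(* Counting edges by their upper ends: every vertex but [rho] has a descending
   edge, a branch vertex has two. *)
Lemma card_branch_vertices (v0 : gV T) : gvtx v0 = rho ->
  (#|branch_vertices| + #|gV T| <= #|gE T| + 1)%N.
Proof.
move=> v0rho; pose dn v := #|[set k | gtgt k == v]%SET|.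
have -> : #|gE T| = (\sum_v dn v)%N.
  rewrite -sum1_card (partition_big (@gtgt _ _ T) xpredT) //=.
  by apply: eq_bigr => v _; rewrite /dn -sum1_card; apply: eq_bigl => k; rewrite inE.
have -> : (#|branch_vertices| + #|gV T| = \sum_v ((v \in branch_vertices) + 1))%N.
  by rewrite big_split /= sum1_card -big_mkcond sum1_card.
rewrite (bigD1 v0) // [X in (_ <= X + _)%N](bigD1 v0) //=.
(* Nothing lies below [rho], so the condition in [non_branch] is vacuous there. *)
have -> : v0 \in branch_vertices = false.
  apply/negbTE; rewrite inE; apply/asboolPn; rewrite notE.
  rewrite v0rho; exists setT; split=> // [x _|]; first by exists 1.
  by move=> q q' _ _ _; rewrite ltNge rho_min.
suff : (\sum_(v | v != v0) ((v \in branch_vertices) + 1) <=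
        \sum_(v | v != v0) dn v)%N by lia.
apply: leq_sum => v vv0.
have [|k kv] := @exists_down_edge v.
  by rewrite -v0rho => /(gs_inj HT) /eqP; rewrite (negbTE vv0).
have [|_] := boolP (v \in branch_vertices); last first.
  by rewrite add0n card_gt0; apply/set0Pn; exists k; rewrite inE kv.
rewrite inE => /asboolP nb.
have [j [jk jv]] : exists j, j != k /\ gtgt j = v.
  apply: contrapT => H; apply: nb; apply: non_branch_down => k1 k2 h1 h2.
  have E j : gtgt j = v -> j = k.
    by move=> jv; apply/eqP; apply: contrapT => /negP jk; apply: H; exists j.
  by rewrite (E _ h1) (E _ h2).
apply: (@leq_trans #|[set j; k]%SET|); first by rewrite cards2 jk.
apply: subset_leq_card; apply/fintype.subsetP => i.
by rewrite !inE => /orP[] /eqP ->; apply/eqP.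
Qed.

End HeightStructure.

(** * Paths along which the height is strictly monotone *)

Section HeightPaths.
Variables (R : realType) (X : Type) (dX : X -> X -> R) (G : Type) (pi : X -> G).
Local Notation Gopen := (Gopen dX pi).
Local Notation rcont := (rcont dX pi).
Local Notation non_branch := (non_branch dX pi).
Implicit Types (a b h : R) (p q : G) (g : R -> G) (phi : G -> R) (A : set G).

(** The height is a parameter so that replacing [phi] by its opposite turns statements on descents
    into statements on ascents. *)
Definition hpath phi a b g : Prop :=
  rcont a b g /\ forall h, a <= h <= b -> phi (g h) = h.

Lemma hpath_sub phi a b a' b' g : a <= a' -> b' <= b ->
  hpath phi a b g -> hpath phi a' b' g.
Proof.
move=> aa bb [cg hg]; split; first exact (rcont_sub aa bb cg).
by move=> h hab; apply: hg; lra.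
Qed.

Lemma rcontN a b g : rcont a b g -> rcont (- b) (- a) (fun h => g (- h)).
Proof.
move=> cg U oU t tab Ut; have [||e [e0 He]] := cg U oU (- t) => //; first lra.
exists e; split=> // s sab st; apply: He; first lra.
by rewrite -opprD normrN.
Qed.

Lemma hpathN phi a b g : hpath phi a b g ->
  hpath (\- phi) (- b) (- a) (fun h => g (- h)).
Proof.
move=> [cg hg]; split; first exact (rcontN cg).
by move=> h hab /=; rewrite hg; lra.
Qed.

(** Real induction downward from [b]: just below a common non-branch point the height determines the
    point, and the Hausdorff property carries agreement to limits. *)
Lemma unique_descent phi a b g g' : Ghausdorff dX pi ->
  hpath phi a b g -> hpath phi a b g' -> g b = g' b ->
  (forall h, a < h <= b -> non_branch phi (g h)) ->
  forall h, a <= h <= b -> g h = g' h.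
Proof.
move=> haus [cg hg] [cg' hg'] gb nb h hab.
rewrite -(opprK h).
apply: (@real_induction R (- b) (- a) (fun t => g (- t) = g' (- t))); last lra.
- by rewrite opprK.
- move=> t tba Hlt.
  have Et : g (- t) = g' (- t) by apply: Hlt; lra.
  have [|U [oU Ut inj]] := nb (- t); first lra.
  have tab : a <= - t <= b by lra.
  have [e [e0 He]] := cg U oU (- t) tab Ut.
  have [|e' [e0' He']] := cg' U oU (- t) tab; first by rewrite /= -Et.
  exists (Num.min e e'); rewrite lt_min e0 e0'; split=> // s sb.
  rewrite -ltrBlDl lt_min => /andP[se se'].
  have sab : a <= - s <= b by lra.
  have ns : `|- s - - t| = s - t by rewrite opprK addrC distrC gtr0_norm; lra.
  apply: inj; rewrite ?hg ?hg' //; last by lra.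
    by apply: He => //; rewrite ns.
  by apply: He' => //; rewrite ns.
- move=> t tba Hlt; apply: contrapT => /haus [U [W [oU oW Ut Wt dis]]].
  have tab : a <= - t <= b by lra.
  have [e [e0 He]] := cg U oU (- t) tab Ut.
  have [e' [e0' He']] := cg' W oW (- t) tab Wt.
  pose s := t - Num.min (Num.min (e / 2) (e' / 2)) (b + t).
  have m0 : 0 < Num.min (Num.min (e / 2) (e' / 2)) (b + t).
    by rewrite !lt_min; lra.
  have m1 : Num.min (Num.min (e / 2) (e' / 2)) (b + t) <= e / 2.
    by rewrite !ge_min lexx.
  have m2 : Num.min (Num.min (e / 2) (e' / 2)) (b + t) <= e' / 2.
    by rewrite !ge_min lexx orbT.
  have m3 : Num.min (Num.min (e / 2) (e' / 2)) (b + t) <= b + t.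
    by rewrite ge_min lexx orbT.
  have Es : g (- s) = g' (- s) by apply: Hlt; rewrite /s; lra.
  have sab : a <= - s <= b by rewrite /s; lra.
  have ns : `|- s - - t| = t - s by rewrite opprK addrC gtr0_norm // /s; lra.
  apply: (dis (g (- s))).
    by apply: He => //; rewrite ns /s; lra.
  by rewrite Es; apply: He' => //; rewrite ns /s; lra.
Qed.

(** Only the points strictly between the ends are required to lie in [A], so that an end may be a
    branch point. *)
Definition dpath phi A p q : Prop := phi p <= phi q /\ exists g,
  [/\ hpath phi (phi p) (phi q) g, g (phi p) = p, g (phi q) = q &
      forall h, phi p < h < phi q -> A (g h)].

Lemma dpath_mono phi A B p q : A `<=` B -> dpath phi A p q -> dpath phi B p q.
Proof.
by move=> AB [le [g [? ? ? H]]]; split=> //; exists g; split=> // h /H /AB.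
Qed.

Lemma dpath_refl phi A p : dpath phi A p p.
Proof.
split=> //; exists (fun=> p); split=> // [|h]; last by lra.
split=> [U oU t tab Ut|h hab]; first by exists 1.
by apply/eqP; rewrite eq_le.
Qed.

Lemma dpathN phi A p q : dpath phi A p q -> dpath (\- phi) A q p.
Proof.
move=> [le [g [hg gp gq H]]]; split; first by rewrite /= lerN2.
exists (fun h => g (- h)); rewrite /= !opprK; split=> //; first exact: hpathN.
by move=> h hh; apply: H; lra.
Qed.

Lemma dpathNK phi A p q : dpath (\- phi) A q p -> dpath phi A p q.
Proof.
have E : \- (\- phi) = phi by apply/funext => z /=; rewrite opprK.
by move=> /dpathN; rewrite E.
Qed.

Lemma dpath_trans phi A p c q : A c ->
  dpath phi A p c -> dpath phi A c q -> dpath phi A p q.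
Proof.
move=> Ac [pc [g [[cg hg] gp gc Ag]]] [cq [g' [[cg' hg'] gc' gq Ag']]].
split; first exact: le_trans pc cq.
pose f h := if h <= phi c then g h else g' h.
have fr h : phi c <= h -> f h = g' h.
  move=> ch; rewrite /f; case: ifP => // hc.
  by have -> : h = phi c by [lra]; rewrite gc.
exists f; split; first split.
- move=> U oU t tab; rewrite /=.
  case: (ltgtP t (phi c)) => tc.
  + rewrite /f (ltW tc) => Ut; have [|//|e [e0 He]] := cg U oU t; first lra.
    exists (Num.min e (phi c - t)); rewrite lt_min; split; first lra.
    move=> s sab; rewrite lt_min !ltr_norml => /andP[h1 h2].
    have -> : s <= phi c by lra.
    by apply: He; [lra | rewrite ltr_norml].
  + rewrite (fr t (ltW tc)) => Ut.
    have [|//|e [e0 He]] := cg' U oU t; first lra.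
    exists (Num.min e (t - phi c)); rewrite lt_min; split; first lra.
    move=> s sab; rewrite lt_min !ltr_norml => /andP[h1 h2].
    rewrite (fr s); last by lra.
    by apply: He; [lra | rewrite ltr_norml].
  + subst t; rewrite /f lexx => Uc.
    have [|//|e [e0 He]] := cg U oU (phi c); first lra.
    have [||e' [e0' He']] := cg' U oU (phi c); first lra.
      by rewrite /= gc' -gc.
    exists (Num.min e e'); rewrite lt_min e0 e0'; split=> // s sab.
    rewrite lt_min => /andP[h1 h2]; case: leP => sc; first by apply: He => //; lra.
    by apply: He' => //; lra.
- move=> h hab; rewrite /f; case: leP => hc; first by apply: hg; lra.
  by apply: hg'; lra.
- by rewrite /f pc.
- by rewrite fr.
- move=> h hab; rewrite /f; case: (ltgtP h (phi c)) => hc.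
  + by apply: Ag; lra.
  + by apply: Ag'; lra.
  + by rewrite hc gc.
Qed.

(** By unique descent from [c], the path down to [p] passes through [q]; its lower part is the
    required path. *)
Lemma dpath_compare phi A p q c : Ghausdorff dX pi -> A `<=` non_branch phi ->
  non_branch phi c -> dpath phi A p c -> dpath phi A q c -> phi p <= phi q ->
  dpath phi A p q.
Proof.
move=> haus Anb nbc [pc [g [hg gp gc Ag]]] [qc [g' [hg' gq gc' Ag']]] pq.
have E : g (phi q) = q.
  rewrite -[RHS]gq; apply: (@unique_descent phi (phi q) (phi c)) => //.
  - exact: hpath_sub hg.
  - by rewrite gc.
  - move=> h hh; have [->|hc] := eqVneq h (phi c); first by rewrite gc.
    by apply/Anb/Ag; move: hc; rewrite neq_lt; lra.
  - by rewrite lexx.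
split=> //; exists g; split=> //; first exact: hpath_sub hg.
by move=> h hh; apply: Ag; lra.
Qed.

Definition joined phi A p q : Prop := dpath phi A p q \/ dpath phi A q p.

(** If [c] is between [p] and [q] in height order, the paths concatenate. If it is above both or
    below both, [dpath_compare] applies to [phi] or to its opposite. *)
Lemma joined_trans phi A p c q : Ghausdorff dX pi ->
  A `<=` non_branch phi -> A `<=` non_branch (\- phi) -> A c ->
  joined phi A p c -> joined phi A c q -> joined phi A p q.
Proof.
move=> haus A1 A2 Ac [pc|cp] [cq|qc].
- by left; apply: dpath_trans pc cq.
- have [le|/ltW le] := leP (phi p) (phi q).
    by left; apply: dpath_compare pc qc le => //; exact: A1.
  by right; apply: dpath_compare qc pc le => //; exact: A1.
- have [le|/ltW le] := leP (phi p) (phi q).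
    left; apply: dpathNK.
    apply: dpath_compare (dpathN cq) (dpathN cp) _ => //; first exact: A2.
    by rewrite lerN2.
  right; apply: dpathNK.
  apply: dpath_compare (dpathN cp) (dpathN cq) _ => //; first exact: A2.
  by rewrite lerN2.
- by right; apply: dpath_trans qc cp.
Qed.

Lemma Gopen_nbhd (U : set G) :
  (forall p, U p -> exists N, [/\ Gopen N, N p & N `<=` U]) -> Gopen U.
Proof.
move=> H x Ux; have [N [oN Nx NU]] := H _ Ux.
by have [e [e0 He]] := oN x Nx; exists e; split=> // y /He /NU.
Qed.

(** * Components of the complement of the vertex set *)

Section Components.
Variables (phi : G -> R) (Vs : set G).
Hypothesis haus : Ghausdorff dX pi.
Hypothesis nb_down : ~` Vs `<=` non_branch phi.
Hypothesis nb_up : ~` Vs `<=` non_branch (\- phi).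
Hypothesis local_join : forall p, exists N, [/\ Gopen N, N p,
  (forall q, N q -> joined phi (~` Vs) p q) &
  (forall q, N q -> q <> p -> ~ Vs q)].
Local Notation J := (joined phi (~` Vs)).

Lemma J_trans p c q : ~ Vs c -> J p c -> J c q -> J p q.
Proof. by move=> Vc; apply: joined_trans. Qed.

Lemma J_sym p q : J p q -> J q p.
Proof. by case=> h; [right|left]. Qed.

(** Local joins make both the points joined to [c] and the points not joined to [c] open in the
    complement of [Vs], so a connected set containing [c] consists of joined points. *)
Lemma component_joined c q : ~ Vs c ->
  Gcomponent dX pi (~` Vs) c q -> J c q /\ ~ Vs q.
Proof.
move=> Vc [C [CV Cc Cc0 Cq]].
have [||||H|H] := Cc [set z | ~ Vs z /\ J c z] [set z | ~ Vs z /\ ~ J c z].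
- apply: Gopen_nbhd => p [Vp Jp]; have [N [oN Np NJ NV]] := local_join p.
  exists N; split=> // z Nz; split; last exact: J_trans (NJ z Nz).
  by have [->//|] := pselect (z = p); exact: NV.
- apply: Gopen_nbhd => p [Vp Jp]; have [N [oN Np NJ NV]] := local_join p.
  have NV' z : N z -> ~ Vs z.
    by move=> Nz; have [->//|] := pselect (z = p); exact: NV.
  exists N; split=> // z Nz; split; first exact: NV'.
  move=> cz; apply: Jp; apply: (J_trans (NV' z Nz) cz).
  exact/J_sym/NJ.
- move=> z Cz; have Vz := CV z Cz.
  by have [|] := pselect (J c z); [left|right].
- by apply/seteqP; split=> // z [[_ [_ h1]] [_ h2]].
- exfalso; have : (C `&` [set z | ~ Vs z /\ J c z]) c.
    by split=> //; split=> //; left; exact: dpath_refl.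
  by rewrite H.
- split; last exact: CV.
  apply: contrapT => nJ.
  have : (C `&` [set z | ~ Vs z /\ ~ J c z]) q by split=> //; split=> //; exact: CV.
  by rewrite H.
Qed.

Lemma closure_component_joined c p : ~ Vs c ->
  Gclosure dX pi (Gcomponent dX pi (~` Vs) c) p -> J p c.
Proof.
move=> Vc clp; have [N [oN Np NJ NV]] := local_join p.
have [z [Cz Nz]] := clp N oN Np.
have [cz Vz] := component_joined Vc Cz.
exact: (J_trans Vz (NJ z Nz) (J_sym cz)).
Qed.

Lemma closure_joined c p q : ~ Vs c ->
  Gclosure dX pi (Gcomponent dX pi (~` Vs) c) p ->
  Gclosure dX pi (Gcomponent dX pi (~` Vs) c) q -> J p q.
Proof.
move=> Vc /(closure_component_joined Vc) pc /(closure_component_joined Vc) qc.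
exact: (J_trans Vc pc (J_sym qc)).
Qed.

End Components.

End HeightPaths.

(** * Lifting walks to the metric space *)

Section MetricQuotient.
Variables (R : realType) (X : Type) (dX : X -> X -> R) (G : Type) (pi : X -> G).
Variables (r : X) (dstar : G -> R).
Hypothesis metric : is_metric dX.
Hypothesis compactX : mcompact dX.
Hypothesis geo : geodesic dX.
Hypothesis pi_surj : forall p, exists x, pi x = p.
Hypothesis dstar_pi : forall x, dstar (pi x) = dX r x.
Local Notation Gopen := (Gopen dX pi).
Local Notation M := (Mfib dX pi).

Lemma dist_ge0 x y : 0 <= dX x y. Proof. by case: metric. Qed.
Lemma dist_refl x : dX x x = 0. Proof. by case: metric => _ H _ _; apply/H. Qed.
Lemma dist_sym x y : dX x y = dX y x. Proof. by case: metric. Qed.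
Lemma dist_tri x y z : dX x z <= dX x y + dX y z. Proof. by case: metric. Qed.

Lemma dist_lip x y : `|dX r x - dX r y| <= dX x y.
Proof.
have h1 := dist_tri r x y; have h2 := dist_tri r y x.
by rewrite (dist_sym y x) in h2; rewrite ler_norml; lra.
Qed.

Lemma dstar_open (c e : R) : Gopen [set q | `|dstar q - c| < e].
Proof.
move=> x /=; rewrite dstar_pi => xe.
exists (e - `|dX r x - c|); split; first lra.
move=> y yx; rewrite /= dstar_pi -(subrK (dX r x) (dX r y)) -addrA.
apply: le_lt_trans (ler_normD _ _) _.
by have := dist_lip y x; rewrite (dist_sym y x); lra.
Qed.

Lemma dstar_ge0 q : 0 <= dstar q.
Proof. by have [x <-] := pi_surj q; rewrite dstar_pi dist_ge0. Qed.

Lemma dstar_root : dstar (pi r) = 0.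
Proof. by rewrite dstar_pi dist_refl. Qed.

Lemma root_geodesic y : exists g : R -> X, [/\ g 0 = r, g (dX r y) = y,
  (forall s, 0 <= s <= dX r y -> dX r (g s) = s) &
  (forall s t, 0 <= s <= dX r y -> 0 <= t <= dX r y ->
     dX (g s) (g t) = `|s - t|)].
Proof.
have [g [g0 g1 gd]] := geo r y; exists g; split=> // s sab.
rewrite -g0 gd //; last by have := dist_ge0 r y; lra.
by rewrite sub0r normrN ger0_norm //; lra.
Qed.

(** Move a short way from a preimage of [p] along a geodesic towards [r]. *)
Lemma lower_point p U : p <> pi r -> Gopen U -> U p ->
  exists2 q, U q & dstar q < dstar p.
Proof.
have [x <-] := pi_surj p => xr oU Ux.
have x0 : 0 < dX r x.
  rewrite lt_neqAle dist_ge0 andbT; apply/eqP => E; apply: xr.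
  by case: metric => _ H _ _; congr pi; apply/esym/H.
have [e [e0 He]] := oU x Ux.
have [g [g0 g1 gr gd]] := root_geodesic x.
pose m := Num.min (e / 2) (dX r x).
have m0 : 0 < m by rewrite lt_min; lra.
have m1 : m <= e / 2 by rewrite ge_min lexx.
have m2 : m <= dX r x by rewrite ge_min lexx orbT.
exists (pi (g (dX r x - m))).
  apply: He; rewrite -{1}g1 gd; [|lra|lra].
  by rewrite opprB addrCA subrr addr0 gtr0_norm //; lra.
by rewrite !dstar_pi gr; lra.
Qed.

Lemma curve_rcont a b (g : R -> X) :
  (forall s t, a <= s <= b -> a <= t <= b -> dX (g s) (g t) = `|s - t|) ->
  rcont dX pi a b (pi \o g).
Proof.
move=> gd U oU t tab Ut; have [e [e0 He]] := oU _ Ut.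
by exists e; split=> // s sab st; apply: He; rewrite gd // distrC.
Qed.

(** Cover [X] by the [e]-neighborhood of the fiber (index [None]) and by preimages of open sets
    disjoint from neighborhoods of [q] (index [Some z]). For a finite subcover, the intersection of
    these neighborhoods is the required [U]. *)
Lemma near_fiber q (e : R) : Ghausdorff dX pi -> 0 < e ->
  exists U, [/\ Gopen U, U q &
    forall z, U (pi z) -> exists2 y, pi y = q & dX y z < e].
Proof.
move=> haus e0.
have /choice[F HF] (z : X) : exists UW : set G * set G,
    [/\ Gopen UW.1, Gopen UW.2, UW.2 q, (forall u, UW.1 u -> UW.2 u -> False) &
      pi z <> q -> UW.1 (pi z)].
  have [->|/haus[U [W [oU oW Uz Wq dis]]]] := pselect (pi z = q).
    by exists (set0, setT); split=> // x _; exists 1.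
  by exists (U, W).
pose N := [set z | exists2 y, pi y = q & dX y z < e].
have [|x|s Hs] := @compactX (option X) (fun o => if o is Some z
    then pi @^-1` (F z).1 else N).
- case=> [z|]; first by have [] := HF z.
  move=> z [y yq yz]; exists (e - dX y z); split; first lra.
  by move=> z' zz'; exists y => //; have := dist_tri y z z'; lra.
- have [xq|xq] := pselect (pi x = q); last first.
    by exists (Some x); have [_ _ _ _] := HF x; apply.
  by exists None; exists x => //; rewrite dist_refl.
have [U [oU Uq HU]] : exists U, [/\ Gopen U, U q & forall z,
    List.In (Some z) s -> forall u, U u -> (F z).1 u -> False].
  elim: s {Hs} => [|o s [U [oU Uq HU]]].
    by exists setT; split=> // x _; exists 1.
  case: o => [z|]; last by exists U; split=> // z [//|]; exact: HU.
  have [_ oW Wq dis _] := HF z; exists (U `&` (F z).2); split=> //.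
    exact: GopenI.
  by move=> z' [[<-]|zs] u [Uu Wu] Fu; [exact: (dis u) | exact: (HU z' zs u)].
exists U; split=> // z Uz; have [[z'|] zs] := Hs z; last by [].
by move=> Fz; case: (HU z' zs _ Uz Fz).
Qed.

(** Makes the suprema in [diam] and [Mfib] genuine upper bounds. *)
Lemma bounded_dist : exists K : R, forall x y, dX x y <= K.
Proof.
have [n|x|s Hs] := @compactX nat (fun n => [set x | dX r x < n%:R]).
- move=> x xn; exists (n%:R - dX r x); split; first by rewrite subr_gt0.
  by move=> y xy; have := dist_tri r x y; rewrite /=; lra.
- exists (Num.truncn (dX r x)).+1; rewrite /=.
  by have /andP[] := truncn_itv (dist_ge0 r x).
have [K HK] : exists K : R, forall n, List.In n s -> n%:R <= K.
  elim: s {Hs} => [|n s [K HK]]; first by exists 0.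
  exists (Num.max n%:R K) => m [<-|ms]; first by rewrite le_max lexx.
  by rewrite le_max HK ?orbT.
exists (K + K) => x y.
have [n ns /= xn] := Hs x; have [m ms /= ym] := Hs y.
have := HK _ ns; have := HK _ ms.
have := dist_tri x r y; rewrite (dist_sym x r); lra.
Qed.

Lemma fiber_dist x y : pi x = pi y -> dX x y <= M.
Proof.
move=> xy; have [K HK] := bounded_dist.
have ubd p : has_ubound [set e | exists x y : X,
    [/\ (pi @^-1` [set p]) x, (pi @^-1` [set p]) y & e = dX x y]].
  by exists K => _ [u [v [_ _ ->]]].
apply: (@le_trans _ _ (diam dX (pi @^-1` [set pi x]))).
  by apply: (ub_le_sup (ubd (pi x))); exists x, y.
apply: ub_le_sup; last by exists (pi x).
exists K => _ [p ->]; apply: ge_sup; last by move=> _ [u [v [_ _ ->]]].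
by have [z zp] := pi_surj p; exists (dX z z), z, z.
Qed.

Lemma M_ge0 : 0 <= M.
Proof. by have := @fiber_dist r r erefl; rewrite dist_refl. Qed.

Hypothesis haus : Ghausdorff dX pi.
Local Notation NB := (non_branch dX pi dstar).
Local Notation dpath := (dpath dX pi dstar).
Local Notation joined := (joined dX pi dstar).

(** The geodesic from [r] to [y] projects to a descent from [q], which by uniqueness passes through
    [p]; its point at that height is [x]. *)
Lemma descent_lift p q y : dpath NB p q -> NB q -> pi y = q ->
  exists2 x, pi x = p & dX x y = dstar q - dstar p.
Proof.
move=> [pq [g [hg gp gq NBg]]] NBq yq.
have [c [c0 c1 cr cd]] := root_geodesic y.
have dq : dX r y = dstar q by rewrite -dstar_pi yq.
have p0 := dstar_ge0 p.
have E : g (dstar p) = (pi \o c) (dstar p).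
  apply: (@unique_descent _ _ dX _ pi dstar (dstar p) (dstar q)) => //.
  - split; last by move=> h hab; rewrite /= dstar_pi cr // dq; lra.
    refine (@curve_rcont (dstar p) (dstar q) c _) => s t sab tab.
    by apply: cd; rewrite dq; lra.
  - by rewrite gq /= -dq c1.
  - move=> h hab; have [->|hq] := eqVneq h (dstar q); first by rewrite gq.
    by apply: NBg; move: hq; rewrite neq_lt; lra.
  - by rewrite lexx.
exists (c (dstar p)); first by rewrite -[RHS]gp E.
rewrite -{1}c1 cd; [|rewrite dq; lra|rewrite dq; lra].
by rewrite dq distrC ger0_norm // subr_ge0.
Qed.

Lemma dpath_eq A p q : dpath A p q -> dstar p = dstar q -> p = q.
Proof. by move=> [_ [g [_ gp gq _]]] E; rewrite -gp E gq. Qed.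

Lemma joined_eq A p q : joined A p q -> dstar p = dstar q -> p = q.
Proof. by case=> h E; [|symmetry]; apply: (dpath_eq h). Qed.

(** Stop on the joining path just before [w]. This replaces a branch point by a nearby non-branch
    point, to which lifting applies, without increasing the length. *)
Lemma nudge p w U : joined NB p w -> p <> w -> Gopen U -> U w ->
  exists w', [/\ U w', NB w', joined NB p w' &
    `|dstar p - dstar w'| <= `|dstar p - dstar w|].
Proof.
move=> J pw oU Uw; have ne : dstar p != dstar w.
  by apply/eqP => /(joined_eq J).
case: J => [[le [g [[cg hg] gp gw NBg]]]|[le [g [[cg hg] gw gp NBg]]]].
  have lt : dstar p < dstar w by rewrite lt_neqAle ne.
  have [||e [e0 He]] := cg U oU (dstar w); rewrite /= ?gw //; first lra.
  pose m := Num.min (e / 2) ((dstar w - dstar p) / 2).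
  have m0 : 0 < m by rewrite lt_min; lra.
  have m1 : m <= e / 2 by rewrite ge_min lexx.
  have m2 : m <= (dstar w - dstar p) / 2 by rewrite ge_min lexx orbT.
  pose h := dstar w - m; have hh : dstar p <= h <= dstar w by rewrite /h; lra.
  exists (g h); rewrite hg //; split.
  - by apply: He => //; rewrite /h addrC addKr normrN gtr0_norm //; lra.
  - by apply: NBg; rewrite /h; lra.
  - left; split; rewrite (hg h hh); first lra.
    exists g; split=> //; last by move=> s sh; apply: NBg; lra.
    by apply: hpath_sub (conj cg hg); lra.
  - by rewrite !(distrC (dstar p)) !ger0_norm; rewrite /h; lra.
have lt : dstar w < dstar p by rewrite lt_neqAle eq_sym ne.
have [||e [e0 He]] := cg U oU (dstar w); rewrite /= ?gw //; first lra.
pose m := Num.min (e / 2) ((dstar p - dstar w) / 2).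
have m0 : 0 < m by rewrite lt_min; lra.
have m1 : m <= e / 2 by rewrite ge_min lexx.
have m2 : m <= (dstar p - dstar w) / 2 by rewrite ge_min lexx orbT.
pose h := dstar w + m; have hh : dstar w <= h <= dstar p by rewrite /h; lra.
exists (g h); rewrite hg //; split.
- by apply: He => //; rewrite /h addrC addKr gtr0_norm //; lra.
- by apply: NBg; rewrite /h; lra.
- right; split; rewrite (hg h hh); first lra.
  exists g; split=> //; last by move=> s sh; apply: NBg; lra.
  by apply: hpath_sub (conj cg hg); lra.
- by rewrite !ger0_norm; rewrite /h; lra.
Qed.

(** [Q] constrains the nodes, whereas the paths between consecutive nodes always run through
    non-branch points. *)
Inductive walk (Q : set G) : G -> G -> R -> Prop :=
| walk0 p : Q p -> walk Q p p 0
| walkS p p' q L : Q p -> joined NB p p' -> walk Q p' q L ->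
    walk Q p q (`|dstar p - dstar p'| + L).

Lemma walk_ge0 Q p q L : walk Q p q L -> 0 <= L.
Proof. by elim=> // *; rewrite addr_ge0. Qed.

Lemma walk_head (Q : set G) p q L : walk Q p q L -> Q p.
Proof. by case. Qed.

Lemma walk_sub (Q Q' : set G) p q L : Q `<=` Q' ->
  walk Q p q L -> walk Q' p q L.
Proof.
move=> QQ; elim=> [z /QQ|z z' w K /QQ Qz J _ IH]; first exact: walk0.
exact: walkS.
Qed.

Lemma walk_rcons (Q : set G) p q q' L : walk Q p q L -> joined NB q q' -> Q q' ->
  walk Q p q' (L + `|dstar q - dstar q'|).
Proof.
move=> W J Qq'; elim: W J => [z Qz|z z' w K Qz J _ IH] J'.
  by rewrite addrC; apply: walkS (walk0 _).
by rewrite -addrA; apply: walkS J (IH J').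
Qed.

(* The lowest point met along the walk lies below both of its ends. *)
Lemma non_branch_walk p q L : walk NB p q L -> exists m,
  [/\ NB m, dpath NB m p, dpath NB m q & dstar p + dstar q - 2 * dstar m <= L].
Proof.
elim=> [z NBz|z z' w K NBz J W [m [NBm mz' mw ineq]]].
  by exists z; split=> //; [exact: dpath_refl|exact: dpath_refl|lra].
have NBz' := walk_head W.
have leN := ler_norm (dstar z - dstar z').
have leN' := ler_norm (- (dstar z - dstar z')); rewrite normrN in leN'.
case: J => [zz'|z'z]; last first.
  exists m; split=> //; [exact: dpath_trans mz' z'z | lra].
have [mz|/ltW zm] := leP (dstar m) (dstar z).
  exists m; split=> //; last by case: zz'; lra.
  exact: (dpath_compare haus _ NBz' mz' zz').
have zm' : dpath NB z m by exact: (dpath_compare haus _ NBz' zz' mz').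
exists z; split=> //; first exact: dpath_refl; first exact: dpath_trans zm' mw.
by case: mz'; lra.
Qed.

(** Lift both descents to the lowest point [m]; the two lifts end in the fiber over [m], which costs
    one jump. *)
Lemma non_branch_walk_dist p q L x y : walk NB p q L -> pi x = p -> pi y = q ->
  dX x y <= L + M.
Proof.
move=> W xp yq; have [m [NBm mp mq ineq]] := non_branch_walk W.
have NBp := walk_head W.
have NBq : NB q by elim: W.
have [u um ux] := descent_lift mp NBp xp.
have [v vm vy] := descent_lift mq NBq yq.
have uv : dX u v <= M by apply: fiber_dist; rewrite um vm.
have := dist_tri x u y; have := dist_tri u v y; rewrite (dist_sym x u); lra.
Qed.

Lemma first_branch (Q : set G) p q L : walk Q p q L -> walk NB p q L \/
  exists w L1 L2, [/\ Q w, ~ NB w, walk Q w q L2, 0 <= L1 /\ L1 + L2 <= L &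
    p = w \/ exists p' L', [/\ walk NB p p' L', joined NB p' w &
      L' + `|dstar p' - dstar w| <= L1]].
Proof.
elim=> [z Qz|z z' y K Qz J W IH].
  have [NBz|NBz] := pselect (NB z); first by left; exact: walk0.
  right; exists z, 0, 0; split=> //; last by left.
    exact: walk0.
  by rewrite addr0.
have [NBz|NBz] := pselect (NB z); last first.
  right; exists z, 0, (`|dstar z - dstar z'| + K); split=> //.
  - exact: walkS J W.
  - by split=> //; rewrite add0r.
  - by left.
case: IH => [IH|[w [L1 [L2 [Qw NBw Ww [L10 LL] H]]]]].
  by left; exact: walkS J IH.
right; exists w, (`|dstar z - dstar z'| + L1), L2; split=> //.
  by have := normr_ge0 (dstar z - dstar z'); split; lra.
right; case: H => [E|[p' [L' [W' J' LL']]]].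
  subst z'; exists z, 0; split=> //; first exact: walk0.
  by lra.
exists p', (`|dstar z - dstar z'| + L'); split=> //; last by lra.
exact: walkS J W'.
Qed.

(** Cutting at the last visit removes [w] from the allowed nodes, which drives the induction on the
    number of branch points. *)
Lemma last_visit (Q : set G) w p q L : walk Q p q L ->
  [\/ walk (Q `\ w) p q L, q = w | exists p' L',
    [/\ joined NB w p', walk (Q `\ w) p' q L' &
      `|dstar w - dstar p'| + L' <= L]].
Proof.
elim=> [z Qz|z z' y K Qz J W IH].
  by have [->|zw] := pselect (z = w); [apply: Or32|apply: Or31; apply: walk0].
case: IH => [IH|->|[p' [L' [J' W' LL]]]].
- have [E|zw] := pselect (z = w).
    by subst z; apply: Or33; exists z', K; split.
  by apply: Or31; apply: walkS J IH.
- exact: Or32.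
- apply: Or33; exists p', L'; split=> //.
  by have := normr_ge0 (dstar z - dstar z'); lra.
Qed.

(** * Walks through finitely many branch points *)

Section Branching.
Variables (V : finType) (vtx : V -> G).

Definition nb_or (B : {set V}) : set G :=
  [set z | NB z \/ exists2 v, v \in B & vtx v = z].

Lemma nudged_lift p w (e : R) : joined NB p w -> p <> w -> 0 < e ->
  exists w' z z', [/\ NB w', joined NB p w',
    `|dstar p - dstar w'| <= `|dstar p - dstar w|, pi z' = w' &
     pi z = w /\ dX z z' < e].
Proof.
move=> J pw e0; have [U [oU Uw HU]] := near_fiber w haus e0.
have [w' [Uw' NBw' J' le]] := nudge J pw oU Uw.
have [z' zw'] := pi_surj w'; have [|z zw zz] := HU z'; first by rewrite zw'.
by exists w', z, z'.
Qed.

(* One jump inside a fiber at the first branch point met and one at the lowest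
   point before it; the rest of the walk starts after the last visit to that
   branch point. *)
Lemma walk_dist n (B : {set V}) p q L x y : (#|B| <= n)%N ->
  walk (nb_or B) p q L -> pi x = p -> pi y = q ->
  dX x y <= L + (2 * n + 1)%:R * M.
Proof.
have M0 := M_ge0.
elim: n B p q L x y => [|n IH] B p q L x y Bn W xp yq.
  have W' : walk NB p q L.
    apply: walk_sub W => z [//|[v]]; move: Bn; rewrite leqn0 cards_eq0 => /eqP ->.
    by rewrite inE.
  by rewrite mul1r; exact: non_branch_walk_dist W' xp yq.
have En : (2 * n.+1 + 1)%:R * M = (2 * n + 1)%:R * M + 2 * M.
  by rewrite -mulrDl -natrD; congr (_%:R * _); lia.
have n0 : 0 <= (2 * n)%:R * M by apply: mulr_ge0.
have En' : (2 * n + 1)%:R * M = (2 * n)%:R * M + M by rewrite natrD mulrDl mul1r.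
have [W'|[w [L1 [L2 [Qw NBw Ww [L10 LL] H]]]]] := first_branch W.
  have := non_branch_walk_dist W' xp yq; lra.
have [//|[v vB vw]] := Qw.
have L20 := walk_ge0 Ww.
(* The walk is nudged off [w] at most twice, on arrival and on departure, and each time costs at
   most [e]. *)
apply/ler_addgt0Pr => e' e0'; pose e := e' / 2; have e0 : 0 < e by rewrite /e; lra.
have [z zw xz] : exists2 z, pi z = w & dX x z <= L1 + M + e.
  case: H => [E|[p' [L' [W' J' LL']]]].
    by exists x; [rewrite xp | rewrite dist_refl; lra].
  have p'w : p' <> w.
    by move=> E; apply: NBw; rewrite -E; elim: W' {J' LL' E}.
  have [w' [z [z' [NBw' J'' le z'w' [zw zz']]]]] := nudged_lift J' p'w e0.
  exists z => //; have := non_branch_walk_dist (walk_rcons W' J'' NBw') xp z'w'.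
  have := dist_tri x z' z; rewrite (dist_sym z' z); lra.
have [W'|E|[p' [L' [J' W' LL']]]] := last_visit w Ww.
- by have [_ /=] := walk_head W'.
- have := @fiber_dist z y; rewrite zw yq => /(_ (esym E)).
  have := dist_tri x z y; rewrite /e in xz; lra.
have [_ /= p'w] := walk_head W'.
have J'' : joined NB p' w by case: J'; [right|left].
have [w' [u [u' [NBw' Jw' le u'w' [uw uu']]]]] := nudged_lift J'' p'w e0.
have W'' : walk (nb_or (B :\ v)%SET) w' q (`|dstar w' - dstar p'| + L').
  apply: walkS; first by left.
    by case: Jw'; [right|left].
  apply: walk_sub W' => a [[NBa|[b bB ba]] /= aw]; first by left.
  right; exists b => //; rewrite !inE bB andbT; apply/eqP => bv.
  by apply: aw; rewrite -ba bv.
have Bn' : (#|B :\ v|%SET <= n)%N by move: Bn; rewrite (cardsD1 v) vB.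
have := IH _ _ _ _ _ _ Bn' W'' u'w' yq.
have zu : dX z u <= M by apply: fiber_dist; rewrite zw uw.
have := dist_tri x z y; have := dist_tri z u y; have := dist_tri u u' y.
rewrite (distrC (dstar w')); rewrite (distrC (dstar p') (dstar w)) in le.
by rewrite /e in xz uu'; lra.
Qed.

End Branching.

End MetricQuotient.

(** * Projecting geodesics to chains of edges *)

Section Chains.
Variables (R : realType) (G : Type) (dstar : G -> R) (E : G -> G -> Prop).

Definition chain_le (p q : G) (L : R) : Prop := exists (n : nat) (f : nat -> G),
  [/\ f 0%N = p, f n = q, (forall i, (i < n)%N -> E (f i) (f i.+1)) &
      \sum_(i < n) `|dstar (f i) - dstar (f i.+1)| <= L].

Lemma chain_le_refl p L : 0 <= L -> chain_le p p L.
Proof. by move=> L0; exists 0%N, (fun=> p); split=> //; rewrite big_ord0. Qed.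

Lemma chain_le_edge p q L : E p q -> `|dstar p - dstar q| <= L ->
  chain_le p q L.
Proof.
move=> Epq le; exists 1%N, (fun i => if i is 0%N then p else q); split=> //.
  by case.
by rewrite big_ord1.
Qed.

Lemma chain_le_trans p c q L1 L2 L : chain_le p c L1 -> chain_le c q L2 ->
  L1 + L2 <= L -> chain_le p q L.
Proof.
move=> [n [f [f0 fn Ef Lf]]] [m [g [g0 gm Eg Lg]]] LL.
pose h i := if (i <= n)%N then f i else g (i - n)%N.
have hl i : (i <= n)%N -> h i = f i by rewrite /h => ->.
have hr i : h (n + i)%N = g i.
  rewrite /h; case: leqP => [le|_]; last by rewrite addKn.
  by have -> : i = 0%N by [lia]; rewrite addn0 fn g0.
exists (n + m)%N, h; split.
- by rewrite hl.
- by rewrite hr.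
- move=> i inm; have [lt|le] := ltnP i n; first by rewrite !hl //; [exact: Ef|exact: ltnW].
  by rewrite -(subnKC le) -addnS !hr; apply: Eg; lia.
- apply: le_trans LL; rewrite big_split_ord /=; apply: lerD.
    apply: le_trans Lf; apply: ler_sum => i _.
    by rewrite !hl //; exact: ltnW.
  by apply: le_trans Lg; apply: ler_sum => i _; rewrite -addnS !hr.
Qed.

End Chains.

(** * Continuous curves in [G] and the edges they traverse *)

Section Curves.
Variables (R : realType) (X : Type) (dX : X -> X -> R) (G : Type) (pi : X -> G).
Local Notation Gopen := (Gopen dX pi).
Local Notation rcont := (rcont dX pi).
Hypothesis haus : Ghausdorff dX pi.
Implicit Types (a b s t u : R) (P : R -> G).

(** Take the infimum of the hitting times; it is itself one, since points are closed in a Hausdorff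
    space. *)
Lemma first_hit a b P (w : G) : a <= b -> rcont a b P -> P b = w ->
  exists u, [/\ a <= u <= b, P u = w & forall s, a <= s < u -> P s <> w].
Proof.
move=> ab cP Pb; pose Z := [set u | a <= u <= b /\ P u = w].
have infZ : has_inf Z.
  split; first by exists b; split=> //; rewrite ab lexx.
  by exists a => u [uab _]; lra.
have lb u : Z u -> inf Z <= u by move=> Zu; apply: (ge_inf (proj2 infZ)).
have am : a <= inf Z by apply: lb_le_inf; [exact: infZ.1 | move=> u [uab _]; lra].
have mb : inf Z <= b by apply: lb; split=> //; rewrite ab lexx.
have mab : a <= inf Z <= b by rewrite am.
exists (inf Z); split=> //; last first.
  move=> s sm Ps; have : inf Z <= s by apply: lb; split=> //; lra.
  lra.
apply: contrapT => /haus[U [W [oU oW Um Ww dis]]].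
have [e [e0 He]] := cP U oU _ mab Um.
have [u [uab Pu] ue] := inf_adherent e0 infZ.
have mu := lb u (conj uab Pu).
apply: (dis (P u)); last by rewrite Pu.
by apply: He => //; rewrite ger0_norm; lra.
Qed.

Lemma last_hit a b P (w : G) : a <= b -> rcont a b P -> P a = w ->
  exists u, [/\ a <= u <= b, P u = w & forall s, u < s <= b -> P s <> w].
Proof.
move=> ab cP Pa; have [|||u [uab Pu Hu]] := @first_hit (- b) (- a) (fun h => P (- h)) w.
- lra.
- exact (rcontN cP).
- by rewrite opprK.
exists (- u); split=> //; first lra.
by move=> s sub; have := Hu (- s); rewrite opprK; apply; lra.
Qed.

Lemma interval_stays a b P (U W : set G) : a <= b -> rcont a b P ->
  Gopen U -> Gopen W -> (forall s, a <= s <= b -> U (P s) \/ W (P s)) ->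
  (forall s, a <= s <= b -> U (P s) -> W (P s) -> False) -> U (P a) -> U (P b).
Proof.
move=> ab cP oU oW cov dis Ua.
apply: (@real_induction R a b (fun t => U (P t))) => //; last by rewrite ab lexx.
- move=> t tab H; have [||e [e0 He]] := cP U oU t; first lra.
    by apply: H; lra.
  by exists e; split=> // s sb st; apply: He; [lra | rewrite gtr0_norm; lra].
- move=> t tab H; have tab' : a <= t <= b by lra.
  have [//|Wt] := cov t tab'; exfalso.
  have [e [e0 He]] := cP W oW t tab' Wt.
  pose s := Num.max a (t - e / 2).
  have s1 : a <= s by rewrite le_max lexx.
  have s2 : t - e / 2 <= s by rewrite le_max lexx orbT.
  have s3 : s < t by rewrite gt_max; lra.
  apply: (dis s); first lra; first by apply: H; lra.
  by apply: He; [lra | rewrite distrC gtr0_norm; lra].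
Qed.

Lemma curve_connected s t P : rcont s t P ->
  Gconnected dX pi [set z | exists2 u, s < u < t & P u = z].
Proof.
move=> cP U W oU oW cov dis; apply: contrapT => /not_orP[].
move=> /eqP/set0P[_ [[u uab <-] Uu]] /eqP/set0P[_ [[v vab <-] Wv]].
have covs h : s < h < t -> U (P h) \/ W (P h).
  by move=> hab; have [] := cov (P h); [exists h | left | right].
have diss h : s < h < t -> U (P h) -> W (P h) -> False.
  move=> hab Uh Wh.
  suff : ([set z | exists2 u, s < u < t & P u = z] `&` U `&` W) (P h) by rewrite dis.
  by split=> //; split=> //; exists h.
have [uv|/ltW vu] := leP u v.
  apply: (diss v vab) => //.
  apply: (@interval_stays u v P U W) => //.
  - by apply: (@rcont_sub _ _ _ _ _ s t) cP; lra.
  - by move=> h hab; apply: covs; lra.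
  - by move=> h hab; apply: diss; lra.
apply: (diss u uab) => //.
apply: (@interval_stays v u P W U) => //.
- by apply: (@rcont_sub _ _ _ _ _ s t) cP; lra.
- by move=> h hab; apply/or_comm/covs; lra.
- by move=> h hab Wh Uh; apply: (diss h) => //; lra.
Qed.

Variables (dstar : G -> R) (Vs : set G).

Definition on_edge (p q : G) : Prop := exists c, ~ Vs c /\
  Gclosure dX pi (Gcomponent dX pi (~` Vs) c) p /\
  Gclosure dX pi (Gcomponent dX pi (~` Vs) c) q.

(** The image of the open interval is connected and avoids [Vs], hence lies in one component, and
    the two ends are limits of its points. *)
Lemma curve_on_edge s t P : s < t -> rcont s t P ->
  (forall u, s < u < t -> ~ Vs (P u)) -> on_edge (P s) (P t).
Proof.
move=> st cP nV; pose m := (s + t) / 2; have mst : s < m < t by rewrite /m; lra.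
exists (P m); split; first exact: nV.
have comp u : s < u < t -> Gcomponent dX pi (~` Vs) (P m) (P u).
  move=> ust; exists [set z | exists2 u, s < u < t & P u = z]; split.
  - by move=> _ [v vst <-]; exact: nV.
  - exact: curve_connected.
  - by exists m.
  - by exists u.
split=> U oU Us.
  have [||e [e0 He]] := cP U oU s => //; first lra.
  pose h := Num.min (e / 2) ((t - s) / 2).
  have h0 : 0 < h by rewrite lt_min; lra.
  have h1 : h <= e / 2 by rewrite ge_min lexx.
  have h2 : h <= (t - s) / 2 by rewrite ge_min lexx orbT.
  exists (P (s + h)); split; first by apply: comp; lra.
  by apply: He; [lra | rewrite addrC addKr gtr0_norm; lra].
have [||e [e0 He]] := cP U oU t => //; first lra.
pose h := Num.min (e / 2) ((t - s) / 2).
have h0 : 0 < h by rewrite lt_min; lra.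
have h1 : h <= e / 2 by rewrite ge_min lexx.
have h2 : h <= (t - s) / 2 by rewrite ge_min lexx orbT.
exists (P (t - h)); split; first by apply: comp; lra.
by apply: He; [lra | rewrite addrC addKr normrN gtr0_norm; lra].
Qed.

(** Induction on the vertices that the curve may still meet in its interior. At one of them, keep
    the part up to its first visit and the part after its last; dropping the middle only shortens
    the chain, and neither part meets this vertex in its interior. *)
Lemma curve_chain (V : finType) (vtx : V -> G) n (B : {set V}) s t P :
  (#|B| <= n)%N -> s <= t -> rcont s t P ->
  (forall u v, s <= u <= t -> s <= v <= t ->
     `|dstar (P u) - dstar (P v)| <= `|u - v|) ->
  (forall u, s < u < t -> Vs (P u) -> exists2 v, v \in B & vtx v = P u) ->
  chain_le dstar on_edge (P s) (P t) (t - s).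
Proof.
elim: n B s t => [|n IH] B s t Bn st cP lip HB.
all: have [E|ne] := eqVneq s t; first by subst t; rewrite subrr; exact: chain_le_refl.
all: have {}st : s < t by rewrite lt_neqAle ne.
all: have edge : (forall u, s < u < t -> ~ Vs (P u)) ->
       chain_le dstar on_edge (P s) (P t) (t - s)
  by move=> H; apply: chain_le_edge; [exact: curve_on_edge |
     apply: le_trans (lip _ _ _ _) _; rewrite ?lexx ?(ltW st) //;
     rewrite distrC gtr0_norm ?subr_gt0].
  apply: edge => u ust /(HB u ust)[v].
  by move: Bn; rewrite leqn0 cards_eq0 => /eqP ->; rewrite inE.
have [H|/existsNP[u /not_implyP[ust /contrapT Vu]]] :=
  pselect (forall u, s < u < t -> ~ Vs (P u)); first exact: edge.
have [v vB vu] := HB u ust Vu.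
have Bn' : (#|B :\ v|%SET <= n)%N by move: Bn; rewrite (cardsD1 v) vB.
have [||u1 [u1s Pu1 Hu1]] := @first_hit s u P (P u) _ _ erefl; first lra.
  by apply: (@rcont_sub _ _ _ _ _ s t) cP; lra.
have [||u2 [u2t Pu2 Hu2]] := @last_hit u t P (P u) _ _ erefl; first lra.
  by apply: (@rcont_sub _ _ _ _ _ s t) cP; lra.
have rem a : (s < a < t) -> Vs (P a) -> P a <> P u ->
    exists2 b, b \in (B :\ v)%SET & vtx b = P a.
  move=> ast Va Pa; have [b bB ba] := HB a ast Va.
  exists b => //; rewrite !inE bB andbT; apply/eqP => bv.
  by apply: Pa; rewrite -ba bv.
apply: (@chain_le_trans _ _ _ _ (P s) (P u) (P t) (u1 - s) (t - u2)); last by lra.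
- rewrite -Pu1; apply: (IH (B :\ v)%SET) => //; first lra.
  + by apply: (@rcont_sub _ _ _ _ _ s t) cP; lra.
  + by move=> a b ha hb; apply: lip; lra.
  + by move=> a ha Va; apply: rem => //; [lra | apply: Hu1; lra].
- rewrite -Pu2; apply: (IH (B :\ v)%SET) => //; first lra.
  + by apply: (@rcont_sub _ _ _ _ _ s t) cP; lra.
  + by move=> a b ha hb; apply: lip; lra.
  + by move=> a ha Va; apply: rem => //; [lra | apply: Hu2; lra].
Qed.

End Curves.

(** * The main estimate *)

Lemma card2_no_three (T : finType) (A : {set T}) x y z : (#|A| <= 2)%N ->
  x \in A -> y \in A -> z \in A -> [\/ x = y, y = z | x = z].
Proof.
move=> A2 xA yA zA; have [->|xy] := eqVneq x y; first exact: Or31.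
have [->|yz] := eqVneq y z; first exact: Or32.
have [->|xz] := eqVneq x z; first exact: Or33.
have : (#|x |: [set y; z]|%SET <= #|A|)%N.
  apply: subset_leq_card; apply/fintype.subsetP => u.
  by rewrite !inE => /or3P[] /eqP ->.
by rewrite cardsU1 cards2 yz !inE negb_or xy xz; lia.
Qed.

(** * The given finite graph as an initial structure *)

Section InitialStructure.
Variables (R : realType) (X : Type) (dX : X -> X -> R) (G : Type) (pi : X -> G).
Variables (S : fin_graph R G).

Definition init_struct : gstruct R G :=
  @GStruct R G 'I_(nV S) 'I_(nE S) (@vtx _ _ S) (@src _ _ S) (@tgt _ _ S)
    (fun=> 0) (fun=> 1) (@emap _ _ S).

Lemma init_refines : is_realization dX pi S ->
  refines dX pi (range (@vtx _ _ S)) [set p | ~ deg_ne2 S p] (nE S) (nV S)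
    init_struct.
Proof.
move=> [inj [[ends int disj cov cont] open]]; split.
- split=> //=; try by move=> k; case: (ends k).
  by move=> k t v tab; exact: int.
- by move=> p [v _ <-]; exists v.
- move=> v /= nd x y z hx hy hz.
  pose A0 := [set k | src k == v]%SET; pose A1 := [set k | tgt k == v]%SET.
  have c2 : (#|A0| + #|A1| = 2)%N.
    (* [deg_ne2] counts elements of classical sets; the count is moved to finite sets. *)
    have E (f : 'I_(nE S) -> 'I_(nV S)) :
        #|[set k | f k == v]%classic| = #|[set k | f k == v]%SET|.
      by apply: eq_card => k; rewrite finset.inE; apply/idP/idP => [/set_mem|?];
        [|apply/mem_set].
    apply/eqP; apply: contrapT => /negP h; apply: nd; exists v; split=> //.
    by rewrite !E.
  pose A := ([set (k, false) | k in A0] :|: [set (k, true) | k in A1])%SET.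
  have A2 : (#|A| <= 2)%N.
    rewrite -c2; apply: leq_trans (leq_card_setU _ _) _.
    by apply: leq_add; apply: leq_imset_card.
  have inA (u : 'I_(nE S) * bool) : @gend _ _ init_struct u = v -> u \in A.
    case: u => k []; rewrite /gend /= => kv; rewrite inE; apply/orP.
      by right; apply/imsetP; exists k => //; rewrite inE kv.
    by left; apply/imsetP; exists k => //; rewrite inE kv.
  exact: (card2_no_three A2 (inA _ hx) (inA _ hy) (inA _ hz)).
- by rewrite /= !card_ord.
Qed.

(** Yields [nE S - nV S + 1 <= betti1 S]. *)
Lemma n_comp_gt0 (v : 'I_(nV S)) : (0 < n_comp (@adj _ _ S) predT)%N.
Proof.
have sym : connect_sym (@adj _ _ S).
  apply: sym_connect_sym => u w; apply/existsP/existsP => -[k];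
    by rewrite orbC => h; exists k.
apply/card_gt0P; exists (fingraph.root (@adj _ _ S) v).
by rewrite !inE /= roots_root.
Qed.

End InitialStructure.

Section MainEstimate.
Variables (R : realType) (X : Type) (dX : X -> X -> R) (G : Type) (pi : X -> G).
Variables (r : X) (dstar : G -> R) (S : fin_graph R G).
Hypothesis metric : is_metric dX.
Hypothesis compactX : mcompact dX.
Hypothesis geo : geodesic dX.
Hypothesis pi_surj : forall p, exists x, pi x = p.
Hypothesis dstar_pi : forall x, dstar (pi x) = dX r x.
Hypothesis real : is_realization dX pi S.
Local Notation Vs := (Vset dX pi r dstar S).
Local Notation NB := (non_branch dX pi dstar).

(** The points required to be vertices of every refinement. Local maxima become vertices by
    themselves in a height structure, by [local_max_vertex]. *)
Let W := range (@vtx _ _ S) `|` [set pi r].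
Let D := [set p | ~ deg_ne2 S p].
Let dopen := dstar_open metric dstar_pi.
Let lower := lower_point metric geo pi_surj dstar_pi.

Lemma exists_height_structure : exists2 T : gstruct R G,
  refines dX pi W D (nE S) (nV S) T & height_param dstar T.
Proof.
have R0 := init_refines real.
have [T1 R1] : exists T1, refines dX pi W D (nE S) (nV S) T1.
  (* If the root is not yet a vertex, the edge containing it is split there. *)
  have [[v vr]|[k [t [tab kt]]]] := gs_cover (rf_struct R0) (pi r).
    exists (init_struct S); case: R0 => h1 h2 h3 h4; split=> // p [/h2//|->].
    by exists v.
  exists (split_struct k t); rewrite /W -kt.
  exact: (split_refines (rf_struct R0) tab R0).
have [|T2 R2 mono] := exists_mono_refinement dopen lower _ R1; first by right.
exists (height_struct dstar T2); first exact: (height_refines dopen (rf_struct R2)).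
exact: (height_structP dopen (rf_struct R2)).
Qed.

Variable T : gstruct R G.
Hypothesis RT : refines dX pi W D (nE S) (nV S) T.
Hypothesis hp : height_param dstar T.
Let HT := rf_struct RT.
Let haus : Ghausdorff dX pi := G_hausdorff dopen HT hp.

Lemma Vset_vertex p : Vs p -> exists v : gV T, gvtx v = p.
Proof.
case=> [[v [vp _]]|[lm|->]].
- by apply: (rf_vtx RT); left; exists v.
- exact: (local_max_vertex HT hp lm).
- by apply: (rf_vtx RT); right.
Qed.

(** A vertex outside [Vs] is neither a local maximum nor the root, so it has an ascending and a
    descending edge; with at most two ends, each is the only one of its kind. *)
Lemma off_Vset_non_branch p : ~ Vs p -> NB p /\ non_branch dX pi (\- dstar) p.
Proof.
move=> nV; have [[v vp]|nv] := pselect (exists v : gV T, gvtx v = p); last first.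
  by apply: (non_branch_interior HT hp) => v vp; apply: nv; exists v.
have Dp : D (gvtx v) by rewrite vp => h; apply: nV; left.
have d2 := rf_deg RT Dp.
have [|k1 k1v] := @exists_up_edge _ _ _ _ _ _ _ HT hp v.
  by rewrite vp => h; apply: nV; right; left.
have [|k2 k2v] := exists_down_edge lower HT hp (v := v).
  by rewrite vp => h; apply: nV; right; right.
rewrite -vp; split.
  apply: (non_branch_down HT hp) => k j kv jv.
  by case: (d2 (k, true) (j, true) (k1, false) kv jv k1v) => -[].
apply: (non_branch_up HT hp) => k j kv jv.
by case: (d2 (k, false) (j, false) (k2, true) kv jv k2v) => -[].
Qed.

(** A small star has no vertex except possibly its center, and each arm is a height-parametrized
    path. *)
Lemma star_joined p : exists N, [/\ Gopen dX pi N, N p,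
  (forall q, N q -> joined dX pi dstar (~` Vs) p q) &
  (forall q, N q -> q <> p -> ~ Vs q)].
Proof.
have [d d0 Hd] := height_gap dstar T p; have rd : star_radius dstar T p d by [].
have offV q : star dstar T p d q -> q <> p -> ~ Vs q.
  by move=> sq qp /Vset_vertex[v]; exact: (star_off_vertex HT hp rd sq qp).
have mid k h : ga k <= h <= gb k -> `|h - dstar p| < d -> h <> dstar p ->
    ~ Vs (gmap (g := T) k h).
  move=> hab hd hne /Vset_vertex[v vk].
  by apply: (gs_int HT (nonvertex_height HT hp rd hab hd hne) (v := v)).
exists (star dstar T p d); split=> //; first exact: (star_open HT hp rd).
  exact: star_center.
move=> q sq; have qd := star_dist hp rd sq.
case: (ltgtP (dstar q) (dstar p)) => qp.
- have [k [k1 k2 k3 k4]] := star_below hp sq qp; right.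
  split; first exact: ltW.
  exists (gmap k); split=> //.
    split; last by move=> h hab; apply: hp; lra.
    exact (rcont_sub k1 k2 (@gs_cont _ _ _ _ _ _ HT k)).
  move=> h hab; apply: mid; [lra | | lra].
  by move: qd; rewrite !ltr_norml; lra.
- have [k [k1 k2 k3 k4]] := star_above hp sq qp; left.
  split; first exact: ltW.
  exists (gmap k); split=> //.
    split; last by move=> h hab; apply: hp; lra.
    exact (rcont_sub k1 k2 (@gs_cont _ _ _ _ _ _ HT k)).
  move=> h hab; apply: mid; [lra | | lra].
  by move: qd; rewrite !ltr_norml; lra.
- by rewrite (star_same_height hp sq qp); left; exact: dpath_refl.
Qed.

Lemma same_edge_joined p q : same_edge dX pi r dstar S p q ->
  joined dX pi dstar NB p q.
Proof.
have sub : ~` Vs `<=` NB by move=> z /off_Vset_non_branch[].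
have sub' : ~` Vs `<=` non_branch dX pi (\- dstar).
  by move=> z /off_Vset_non_branch[].
move=> [c [Vc [cp cq]]].
have [h|h] := closure_joined haus sub sub' star_joined Vc cp cq.
  by left; exact: dpath_mono h.
by right; exact: dpath_mono h.
Qed.

Local Notation B := (branch_vertices dX pi dstar T).

(** Interior points of edges are non-branch, so every point of [G] is either non-branch or one of
    the finitely many branch vertices. *)
Lemma edge_chain_walk n (f : nat -> G) :
  (forall i, (i < n)%N -> same_edge dX pi r dstar S (f i) (f i.+1)) ->
  walk dX pi dstar (nb_or dX pi dstar (@gvtx _ _ T) B) (f 0%N) (f n)
    (\sum_(i < n) `|dstar (f i) - dstar (f i.+1)|).
Proof.
have all_nodes z : nb_or dX pi dstar (@gvtx _ _ T) B z.
  have [NBz|NBz] := pselect (NB z); first by left.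
  right; have [[v vz]|nv] := pselect (exists v : gV T, gvtx v = z); last first.
    case: NBz; apply: (proj1 (non_branch_interior HT hp _)) => v vz.
    by apply: nv; exists v.
  by exists v => //; rewrite inE vz; apply/asboolP.
elim: n f => [|n IH] f Ef; first by rewrite big_ord0; exact: walk0.
rewrite big_ord_recl /=; apply: walkS => //.
  exact/same_edge_joined/Ef.
by apply: (IH (fun i => f i.+1)) => i ni; apply: Ef.
Qed.

Lemma dist_chain x y : chain_le dstar (same_edge dX pi r dstar S)
  (pi x) (pi y) (dX x y).
Proof.
have [g [g0 g1 gd]] := geo x y.
have -> : dX x y = dX x y - 0 by rewrite subr0.
rewrite -{1}g0 -{1}g1.
apply: (@curve_chain _ _ _ _ pi haus dstar Vs (gV T) (@gvtx _ _ T) _ finset.setT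
  0 (dX x y) (pi \o g) (leqnn _)).
- exact: dist_ge0.
- exact (curve_rcont gd).
- move=> u v uab vab; rewrite /= !dstar_pi -(gd u v uab vab); exact: (dist_lip _ metric).
- by move=> u _ /Vset_vertex[v vu]; exists v; rewrite ?inE.
Qed.

(** The projected geodesic is one chain, which bounds [dG] above by [dX x y]; [walk_dist], applied
    to every chain, gives the other bound. *)
Lemma correspondence_distortion x y :
  `|dX x y - dG dX pi r dstar S (pi x) (pi y)| <=
    (2 * #|B| + 1)%:R * Mfib dX pi.
Proof.
set Ls := [set L | exists (n : nat) (f : nat -> G),
    [/\ f 0%N = pi x, f n = pi y,
        (forall i, (i < n)%N -> same_edge dX pi r dstar S (f i) (f i.+1)) &
        L = \sum_(i < n) `|dstar (f i) - dstar (f i.+1)|]].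
have [n [f [f0 fn Ef Lf]]] := dist_chain x y.
have up : dX x y - (2 * #|B| + 1)%:R * Mfib dX pi <= inf Ls.
  apply: lb_le_inf; first by eexists; exists n, f.
  move=> _ [m [g [gx gy Eg ->]]].
  have W0 := edge_chain_walk Eg; rewrite gx gy in W0.
  have := walk_dist metric compactX geo pi_surj dstar_pi haus
    (leqnn #|B|) W0 erefl erefl; lra.
have low : inf Ls <= dX x y.
  apply: le_trans Lf; apply: ge_inf; last by exists n, f.
  by exists 0 => _ [m [g [_ _ _ ->]]]; apply: sumr_ge0.
have M0 := M_ge0 r metric compactX pi_surj.
have c0 : 0 <= (2 * #|B| + 1)%:R * Mfib dX pi by apply: mulr_ge0.
rewrite /dG -/Ls ler_norml; lra.
Qed.

(** Subdivision preserves the number of edges minus the number of vertices, so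
    [card_branch_vertices] bounds [#|B|] by [nE S - nV S + 1]. *)
Lemma card_branch_le_betti1 : (#|B|%:Z <= betti1 S)%R.
Proof.
have [|v0 v0r] := rf_vtx RT (p := pi r); first by right.
have min q : dstar (pi r) <= dstar q.
  by rewrite (dstar_root metric dstar_pi) (dstar_ge0 metric pi_surj dstar_pi).
have cB := card_branch_vertices lower min HT hp v0r.
have card := rf_card RT.
have [v _] : exists v : 'I_(nV S), True.
  have [_ [[_ _ _ cov _] _]] := real.
  by have [[v _]|[k _]] := cov (pi r); [exists v | exists (src k)].
have nc := n_comp_gt0 v.
by rewrite /betti1; lia.
Qed.

Lemma gh_dist_le : gh_dist dX (dG dX pi r dstar S) <=
  (2 * #|B| + 1)%:R * Mfib dX pi / 2.
Proof.
have M0 := M_ge0 r metric compactX pi_surj.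
rewrite ler_pM2r ?invr_gt0 //; apply: ge_inf; first by exists 0 => e [].
split; first by apply: mulr_ge0.
exists (fun x p => pi x = p); split=> // [x|x p y q <- <-]; first by exists (pi x).
exact: correspondence_distortion.
Qed.

End MainEstimate.

Theorem theorem1 (R : realType) (X : Type) (dX : X -> X -> R) (r : X)
    (eqv : X -> X -> Prop) (G : Type) (pi : X -> G) (dstar : G -> R)
    (S : fin_graph R G) :
  is_metric dX -> mcompact dX -> geodesic dX ->
  reeb_or_alpha_reeb dX r eqv ->
  is_quotient pi eqv ->
  (forall x, dstar (pi x) = dX r x) ->
  is_realization dX pi S ->
  0 < Mfib dX pi ->
  gh_dist dX (dG dX pi r dstar S) < (betti1 S + 1)%:~R * Mfib dX pi.
Proof.
move=> metric compactX geo _ [pi_surj _] dstar_pi real M0.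
have [T RT hp] := exists_height_structure metric geo pi_surj dstar_pi real.
have le := gh_dist_le metric compactX geo pi_surj dstar_pi RT hp.
apply: (le_lt_trans le).
have cB := card_branch_le_betti1 metric geo pi_surj dstar_pi real RT hp.
set j := #|_| in cB *.
(* Half the distortion is [(j + 1/2) M]; strictness comes from [0 < M]. *)
apply: (@lt_le_trans _ _ ((j%:Z + 1)%:~R * Mfib dX pi)).
  rewrite natrD natrM intrD mulrDl [X in _ < X]mulrDl pmulrn.
  lra.
by rewrite ler_pM2r // ler_int lerD2r.
Qed.
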